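(* Let $R$ be a non-discrete irreducible, continuous ring. Then the unit group $\mathrm{GL}(R)$ has uncountable strong cofinality.
   Context: All rings are associative and unital. A ring $R$ is (von Neumann) regular if for every $a \in R$ there is $b \in R$ with $aba = a$. For a regular ring $R$, the set $\mathrm{L}(R) = \{ aR \mid a \in R \}$ of principal right ideals, ordered by inclusion, is a complemented modular lattice. A continuous ring is a regular ring $R$ such that the lattice $\mathrm{L}(R)$ is complete and satisfies $I \wedge \bigvee C = \bigvee \{ I \wedge J \mid J \in C\}$ and $I \vee \bigwedge C = \bigwedge \{ I \vee J \mid J \in C\}$ for every chain $C \subseteq \mathrm{L}(R)$ and every $I \in \mathrm{L}(R)$. A ring is irreducible if it is non-zero and not isomorphic to a direct product of two non-zero rings. $\mathrm{E}(R) = \{ e \in R \mid e^2 = e \}$; $e,f \in \mathrm{E}(R)$ are orthogonal if $ef=fe=0$. A rank function on a regular ring $R$ is a map $\rho \colon R \to [0,1]$ such that $\rho(1)=1$; $\rho(ab) \leq \min\{\rho(a),\rho(b)\}$ for all $a,b \in R$; $\rho(e+f) = \rho(e)+\rho(f)$ for orthogonal $e,f \in \mathrm{E}(R)$; and $\rho(a) > 0$ for all $a \in R \setminus \{0\}$. By von Neumann, every irreducible, continuous ring $R$ admits a unique rank function, denoted $\mathrm{rk}_R$, and $d_R(a,b) = \mathrm{rk}_R(a-b)$ is a (complete) metric on $R$. The ring $R$ is called discrete if the topology on $R$ generated by $d_R$ is discrete, and non-discrete otherwise. $\mathrm{GL}(R)$ is the group of units of $R$. A group $G$ has uncountable strong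 cofinality if, for every sequence $(W_n)_{n \in \mathbb{N}}$ of subsets of $G$ with $W_n \subseteq W_{n+1}$ for all $n$ and $\bigcup_{n \in \mathbb{N}} W_n = G$, there exist $m,n \in \mathbb{N}$ such that $W_n^m = G$, where $W^m = \{ w_1 \cdots w_m \mid w_1,\ldots,w_m \in W \}$. *)

(* Defs.v *)
From HB Require Import structures.
From mathcomp Require Import all_boot all_order all_algebra.
From mathcomp Require Import boolp classical_sets reals.

Set Implicit Arguments.
Unset Strict Implicit.
Unset Printing Implicit Defensive.

Import Order.TTheory GRing.Theory Num.Theory.
Local Open Scope classical_set_scope.
Local Open Scope ring_scope.

Definition regular_ring (R : pzRingType) : Prop :=
  forall a : R, exists b : R, a * b * a = a.

(* The poset L(R): subtype of [set R], with the inclusion order of [set R]. *)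
Section PrincipalRightIdeals.
Variable R : pzRingType.

Definition principal_right_ideal (a : R) : set R := [set a * x | x in setT].

Record pideal := PIdeal {
  pideal_set :> set R;
  _ : `[< exists a : R, pideal_set = principal_right_ideal a >]
}.

HB.instance Definition _ := [isSub for pideal_set].
HB.instance Definition _ := [Choice of pideal by <:].
HB.instance Definition _ := [SubChoice_isSubPOrder of pideal by <: with set_display].

Lemma pideal_leP (I J : pideal) :
  reflect (pideal_set I `<=` pideal_set J) (I <= J)%O.
Proof. by apply: (iffP idP) => /subsetPset. Qed.

End PrincipalRightIdeals.

(* [supremums A] and [infimums A] are the sets of all least upper bounds and
   greatest lower bounds of [A] (each has at most one element); joins and meets
   are thus given relationally, as L(R) has no lattice structure a priori. *)
Section ContinuousLattices.
Variables (d : Order.disp_t) (L : porderType d).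
Implicit Types (C : set L) (x y z s m : L).

Definition complete_lattice : Prop :=
  forall A : set L, supremums A !=set0 /\ infimums A !=set0.

Definition chain C : Prop := total_on C (fun x y => (x <= y)%O).

Definition is_join x y s : Prop := supremums [set x; y] s.
Definition is_meet x y m : Prop := infimums [set x; y] m.

Definition meet_continuous : Prop :=
  forall C x s m, chain C -> supremums C s -> is_meet x s m ->
    supremums [set y | exists2 z, C z & is_meet x z y] m.

Definition join_continuous : Prop :=
  forall C x m s, chain C -> infimums C m -> is_join x m s ->
    infimums [set y | exists2 z, C z & is_join x z y] s.

End ContinuousLattices.
Arguments complete_lattice {d} L.
Arguments meet_continuous {d} L.
Arguments join_continuous {d} L.

Definition continuous_ring (R : pzRingType) : Prop :=
  [/\ regular_ring R,
      complete_lattice (pideal R),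
      meet_continuous (pideal R) &
      join_continuous (pideal R)].

Definition irreducible_ring (R : pzRingType) : Prop :=
  (1 : R) <> 0 /\
  ~ exists (S T : nzRingType) (f : {rmorphism R -> (S * T)%type}), bijective f.

Section RankFunctions.
Variables (K : realType) (R : pzRingType).
Implicit Types (rho : R -> K) (a b e f : R).

Definition idempotent_elt e : Prop := e * e = e.
Definition orthogonal_elts e f : Prop := e * f = 0 /\ f * e = 0.

Definition rank_function rho : Prop :=
  [/\ forall a, 0 <= rho a <= 1,
      rho 1 = 1,
      forall a b, rho (a * b) <= Num.min (rho a) (rho b),
      forall e f, idempotent_elt e -> idempotent_elt f ->
        orthogonal_elts e f -> rho (e + f) = rho e + rho f &
      forall a, a <> 0 -> 0 < rho a].

Definition rank_dist rho a b : K := rho (a - b).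

Definition rank_open rho (U : set R) : Prop :=
  forall a, U a ->
    exists2 r : K, 0 < r & [set b | rank_dist rho a b < r] `<=` U.

Definition rank_discrete rho : Prop := forall U : set R, rank_open rho U.

End RankFunctions.

Section GeneralLinear.
Variable R : unitRingType.

Record GL := MkGL { GL_val :> R; GL_unitP : GL_val \is a GRing.unit }.

HB.instance Definition _ := [isSub for GL_val].
HB.instance Definition _ := [Choice of GL by <:].

Definition GL_one : GL := MkGL (unitr1 R).
Definition GL_inv (u : GL) : GL :=
  MkGL (etrans (unitrV (GL_val u)) (GL_unitP u)).
Definition GL_mul (u v : GL) : GL :=
  MkGL (etrans (unitrMl (GL_val u) (GL_unitP v)) (GL_unitP u)).

Fact GL_mulA : associative GL_mul.
Proof. by move=> u v w; apply: val_inj; rewrite /= mulrA. Qed.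
Fact GL_mul1 : left_id GL_one GL_mul.
Proof. by move=> u; apply: val_inj; rewrite /= mul1r. Qed.
Fact GL_mulr1 : right_id GL_one GL_mul.
Proof. by move=> u; apply: val_inj; rewrite /= mulr1. Qed.
Fact GL_mulV : left_inverse GL_one GL_inv GL_mul.
Proof. by move=> u; apply: val_inj; rewrite /= mulVr ?GL_unitP. Qed.
Fact GL_mulrV : right_inverse GL_one GL_inv GL_mul.
Proof. by move=> u; apply: val_inj; rewrite /= mulrV ?GL_unitP. Qed.

HB.instance Definition _ :=
  isGroup.Build GL GL_mulA GL_mul1 GL_mulr1 GL_mulV GL_mulrV.

End GeneralLinear.

Definition set_power (G : groupType) (W : set G) (m : nat) : set G :=
  [set \big[*%g/1%g]_(i < m) w i | w in [set w : 'I_m -> G | forall i, W (w i)]].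

Definition uncountable_strong_cofinality (G : groupType) : Prop :=
  forall W : nat -> set G,
    (forall n, W n `<=` W n.+1) -> \bigcup_n W n = setT ->
    exists m n : nat, set_power (W n) m = setT.

(* Main.v *)
Require Import Defs.
From HB Require Import structures.
From mathcomp Require Import all_boot all_order all_algebra.
From mathcomp Require Import boolp classical_sets reals.
From mathcomp Require Import lra.

(* For orthogonal idempotents p, r put E(p, r) = {1 + a | a in pRr}; the theorem
   follows from two facts.

   (1) Every E(p, r) lies in some W_n^m.  Halve r repeatedly inside two disjoint
   parts of r, obtaining orthogonal sequences (s_n) and (d_n) with s_n ~ d_n.
   Since L(R) is upper continuous, elements a_n of pRs_n glue to one A in pRr
   with A s_n = a_n; so a diagonal argument gives an n such that every a in pRs_n
   is of the form A s_n with 1 + A and 1 - A in W_n.  For x in s_nRd_n the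
   commutator of 1 + A and 1 + x is 1 + Ax = 1 + ax, whence E(p, d_n) lies in some
   W_k^m, and finitely many conjugates of it make up E(p, r).

   (2) GL(R) is a product of finitely many sets E(p, r).  As in stable K-theory, a
   unit is modulo transvections supported on half of 1, or on a quarter.  That
   unit is killed by a swindle through pieces of ranks tending to 0: t_n = x_n s_n
   with x_n a product of transvections and s_n a unit of half the support, and
   diag(s_n, s_n^-1) is a product of transvections moving s_n to the next piece,
   where it is t_(n+1).  By gluing, the infinitely many transvections
   amount to finitely many.

   Halving, the equivalence of orthogonal idempotents of equal rank, and thereby
   the stable range condition, follow from Zorn's lemma for perspectivities. *)

Set Implicit Arguments.
Unset Strict Implicit.
Unset Printing Implicit Defensive.

Import Order.TTheory GRing.Theory Num.Theory.
Local Open Scope classical_set_scope.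
Local Open Scope ring_scope.

(** * Identities in noncommutative rings *)

Section NoncommutativeNormalization.
Variable R : pzRingType.
Implicit Types a b c x y z u t : R.

Lemma mul_tail a b c y : a * b = c -> a * (b * y) = c * y.
Proof. by move=> <-; rewrite mulrA. Qed.

Lemma mul_tail2 a b c d y : a * (b * c) = d -> a * (b * (c * y)) = d * y.
Proof. by move=> <-; rewrite !mulrA. Qed.

Lemma mul_tail3 a b c d e y :
  a * (b * (c * d)) = e -> a * (b * (c * (d * y))) = e * y.
Proof. by move=> <-; rewrite !mulrA. Qed.

Lemma pull_tail x a t u : t = x + u -> a + t = x + (a + u).
Proof. by move=> ->; rewrite addrCA. Qed.

Lemma cancel_pos x t u : t = - x + u -> u = 0 -> x + t = 0.
Proof. by move=> -> ->; rewrite addr0 subrr. Qed.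

Lemma cancel_neg x t u : t = x + u -> u = 0 -> - x + t = 0.
Proof. by move=> -> ->; rewrite addr0 addNr. Qed.

(** The extra [0] gives every summand a tail, so that [pull] can also match the last one. *)
Lemma append0 x : x + 0 = 0 -> x = 0.
Proof. by rewrite addr0. Qed.

Lemma mulr_eq0_sub a b e f : a * e = a -> f * b = b -> e * f = 0 -> a * b = 0.
Proof. by move=> <- <- ef; rewrite mulrA -(mulrA a) ef mulr0 mul0r. Qed.

End NoncommutativeNormalization.

Ltac nc_expand :=
  rewrite ?(mulrDl, mulrDr, mulNr, mulrN, mul1r, mulr1, mul0r, mulr0,
            opprD, opprK, oppr0, addr0, add0r) -?mulrA.

(** Longer words are tried first. Products are associated to the right, so a word stands at the end
    of a product or is followed by a tail. *)
Ltac nc_step :=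
  match goal with
  | H : ?a * (?b * (?c * ?d)) = _ |- context [?a * (?b * (?c * ?d))] => rewrite H
  | H : ?a * (?b * (?c * ?d)) = _ |- context [?a * (?b * (?c * (?d * ?y)))] =>
      rewrite (mul_tail3 y H)
  | H : ?a * (?b * ?c) = _ |- context [?a * (?b * ?c)] => rewrite H
  | H : ?a * (?b * ?c) = _ |- context [?a * (?b * (?c * ?y))] =>
      rewrite (mul_tail2 y H)
  | H : ?a * ?b = _ |- context [?a * ?b] => rewrite H
  | H : ?a * ?b = _ |- context [?a * (?b * ?y)] => rewrite (mul_tail y H)
  end.

(* Copies of [1] may carry syntactically different ring structures. *)
Ltac same_monomial x y :=
  lazymatch x with
  | @GRing.one _ => lazymatch y with @GRing.one _ => constr:(tt) end
  | _ => lazymatch y with x => constr:(tt) end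
  end.

Ltac pull x t :=
  match t with
  | @Algebra.add _ ?y ?u =>
      let _ := same_monomial x y in constr:(erefl t)
  | @Algebra.add _ ?a ?u => let p := pull x u in constr:(pull_tail a p)
  end.

Ltac pull_opp x t :=
  match t with
  | @Algebra.add _ (@Algebra.opp _ ?y) ?u =>
      let _ := same_monomial x y in constr:(erefl t)
  | @Algebra.add _ ?a ?u => let p := pull_opp x u in constr:(pull_tail a p)
  end.

Ltac zcancel :=
  repeat match goal with
  | |- - ?x + ?t = 0 => let p := pull x t in apply: (cancel_neg p)
  | |- ?x + ?t = 0 => let p := pull_opp x t in apply: (cancel_pos p)
  end.

(* Normalizes both sides of an identity, rewriting with the relations
   [word = _] (words of at most four letters) found in the context. *)
Ltac nc :=
  unfold idempotent_elt, orthogonal_elts in *;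
  repeat match goal with H : _ /\ _ |- _ => destruct H end;
  apply: subr0_eq; nc_expand; repeat (nc_step; nc_expand);
  apply: append0; rewrite -?addrA; zcancel; rewrite ?addr0; try reflexivity.

(** * Principal right ideals *)

Definition pideal_mem (R : pzRingType) (I : pideal R) : R -> Prop :=
  pideal_set I.
Coercion pideal_mem : pideal >-> Funclass.

Section PrincipalIdeals.
Variable R : pzRingType.
Implicit Types (a b c e f g x y z : R) (I J K : pideal R).

Definition pid a : pideal R :=
  @PIdeal R (principal_right_ideal a) (asboolT (ex_intro _ a erefl)).

Lemma pidP a x : pid a x <-> exists y, x = a * y.
Proof. by split=> [[y _ <-]|[y ->]]; exists y. Qed.

Lemma pideal_gen I : exists a, I = pid a.
Proof.
have /asboolP[a Ia] := valP I.
by exists a; apply: val_inj; rewrite /= -Ia.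
Qed.

Lemma pideal_mulr I x y : I x -> I (x * y).
Proof.
have [a ->] := pideal_gen I => /pidP[z ->].
by apply/pidP; exists (z * y); rewrite mulrA.
Qed.

Lemma pideal0 I : I 0.
Proof.
by have [a ->] := pideal_gen I; apply/pidP; exists 0; rewrite mulr0.
Qed.

Lemma pidealD I x y : I x -> I y -> I (x + y).
Proof.
have [a ->] := pideal_gen I => /pidP[u ->] /pidP[v ->].
by apply/pidP; exists (u + v); rewrite mulrDr.
Qed.

Lemma pidealN I x : I x -> I (- x).
Proof. by move=> Ix; rewrite -mulrN1; apply: pideal_mulr. Qed.

Lemma pidealB I x y : I x -> I y -> I (x - y).
Proof. by move=> Ix Iy; apply: pidealD => //; apply: pidealN. Qed.

Lemma pid_id a : pid a a.
Proof. by apply/pidP; exists 1; rewrite mulr1. Qed.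

Lemma pid_le a I : (pid a <= I)%O <-> I a.
Proof.
split=> [/pideal_leP le_aI|Ia]; first exact/le_aI/pid_id.
by apply/pideal_leP => x /pidP[y ->]; apply: pideal_mulr.
Qed.

Lemma pid_idemP e x : idempotent_elt e -> pid e x <-> e * x = x.
Proof.
move=> ee; split=> [/pidP[y ->]|<-]; first by rewrite mulrA ee.
by apply/pidP; exists x.
Qed.

Definition disj I J := forall x, I x -> J x -> x = 0.

Hypothesis R_regular : regular_ring R.

Lemma idem_gen I : exists2 e, idempotent_elt e & forall x, I x <-> e * x = x.
Proof.
have [a ->] := pideal_gen I; have [b aba] := R_regular a.
exists (a * b); first by rewrite /idempotent_elt mulrA aba.
move=> x; split=> [/pidP[y ->]|<-]; first by rewrite mulrA aba.
by apply/pidP; exists (b * x); rewrite mulrA.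
Qed.

(** If [e] generates [I] and [f * e = e], then [e * f] generates [I] as well and lies in the corner
    [fRf]. *)
Lemma idem_gen_le I f : idempotent_elt f -> (forall x, I x -> f * x = x) ->
  exists e, [/\ idempotent_elt e, f * e = e, e * f = e
              & forall x, I x <-> e * x = x].
Proof.
move=> ff If; have [e ee eI] := idem_gen I.
have fe : f * e = e by apply: If; apply/eI.
exists (e * f); split; try nc.
move=> x; split=> [Ix|efx]; first by rewrite -mulrA (If x Ix); apply/eI.
by apply/eI; rewrite -efx; nc.
Qed.

Lemma pideal_sum I J :
  exists K, forall x, K x <-> exists a b, [/\ I a, J b & x = a + b].
Proof.
have [e ee eI] := idem_gen I; have [f ff fJ] := idem_gen J.
have [g gg gI] := idem_gen (pid ((1 - e) * f)).
have eg : e * g = 0.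
  have /gI/pidP[y ->] : g * g = g := gg.
  by nc.
have [h def_g] : exists h : R, g = (1 - e) * f * h by apply/pidP/gI.
(* Since [e * g = 0], this generator is idempotent, and its right ideal is
   [eR + (1 - e)fR = eR + fR]. *)
exists (pid (e + g * (1 - e))) => x; rewrite pid_idemP; last by nc.
split=> [<-|[a [b [/eI ea /fJ fb ->]]]].
  exists (e * x - e * (f * (h * ((1 - e) * x)))), (f * (h * ((1 - e) * x))).
  split; [apply/eI; nc | apply/fJ; nc |].
  by rewrite mulrDl [in LHS]def_g; nc.
have gefb : g * ((1 - e) * f * b) = (1 - e) * f * b.
  by apply/gI/pidP; exists b.
have -> : (e + g * (1 - e)) * (a + b) = a + e * b + g * ((1 - e) * f * b).
  by nc.
by rewrite gefb; nc.
Qed.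

Hypothesis R_complete : complete_lattice (pideal R).

Lemma supremums_exists (C : set (pideal R)) : exists S, supremums C S.
Proof. by have [[S]] := R_complete C; exists S. Qed.

Hypothesis R_meetc : meet_continuous (pideal R).

(** By upper continuity the meet of [I] and [S] is the supremum of the meets of [I] with the members
    of [C], all of which are zero. *)
Lemma disj_sup (C : set (pideal R)) I S : chain C -> supremums C S ->
  (forall J, C J -> disj I J) -> disj I S.
Proof.
move=> cC supS dC x Ix Sx.
have [_ [M meetM]] := R_complete [set I; S].
have [_ /(_ (pid 0)) M0] := R_meetc cC supS meetM.
have /pideal_leP M0' : (M <= pid 0)%O.
  apply: M0 => y [J CJ [lb_y _]]; apply/pideal_leP => z yz.
  have -> : z = 0; last exact: (pideal0 (pid 0)).
  apply: (dC J CJ).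
    by have /pideal_leP := lb_y I (or_introl erefl); apply.
  by have /pideal_leP := lb_y J (or_intror erefl); apply.
have /pid_le/M0'/pidP[z ->] : (pid x <= M)%O; last by rewrite mul0r.
by case: meetM => _; apply => _ [->|->]; apply/pid_le.
Qed.

Lemma supremums_sub (C : set (pideal R)) S I : supremums C S ->
  (forall J, C J -> forall x, J x -> I x) -> forall x, S x -> I x.
Proof.
move=> [_ leS] CI; apply/pideal_leP/leS => J CJ.
by apply/pideal_leP => x; apply: CI.
Qed.

Lemma supremums_ub (C : set (pideal R)) S J : supremums C S -> C J ->
  forall x, J x -> S x.
Proof. by move=> [ubS _] CJ; apply/pideal_leP/ubS. Qed.

(* The graphs of [a_0 + ... + a_(N-1)] form a chain of right ideals disjoint
   from [pR], hence so is their supremum, which is the graph of the sum. *)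
Lemma glue p q (s a : nat -> R) : idempotent_elt p -> idempotent_elt q ->
  orthogonal_elts p q ->
  (forall n, idempotent_elt (s n) /\ q * s n = s n) ->
  (forall n, s n * q = s n) ->
  (forall m n, m <> n -> s m * s n = 0) ->
  (forall n, p * a n = a n /\ a n * s n = a n) ->
  exists A, [/\ p * A = A, A * q = A & forall n, A * s n = a n].
Proof.
move=> pp qq [pq qp] ss sq orths pas.
pose G N := \sum_(n < N) (s n + a n).
have sp m : s m * p = 0 by rewrite -sq -mulrA qp mulr0.
have sa m n : s m * a n = 0.
  by have [<- _] := pas n; rewrite mulrA sp mul0r.
have sG N m : (m < N)%N -> s m * G N = s m.
  move=> mN; rewrite /G mulr_sumr (bigD1 (Ordinal mN)) //= big1 ?addr0.
    by rewrite mulrDr sa addr0; case: (ss m).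
  move=> i /eqP nim; rewrite mulrDr sa addr0.
  by apply: orths => mi; apply: nim; apply: val_inj.
have Gs N m : (m < N)%N -> G N * s m = s m + a m.
  move=> mN; rewrite /G mulr_suml (bigD1 (Ordinal mN)) //= big1 ?addr0.
    have [[ssm qsm] [pam ams]] := (ss m, pas m).
    by rewrite mulrDl ssm ams.
  move=> i /eqP nim; have [pam ams] := pas i.
  have smi : s i * s m = 0 by apply: orths => mi; apply: nim; apply: val_inj.
  by rewrite -ams; nc.
have GE N : G N = \sum_(n < N) G N * s n.
  by apply: eq_bigr => i _; rewrite Gs.
pose C := [set pid (G N) | N in setT].
have GC N : C (pid (G N)) by exists N.
have leG N M : (N <= M)%N -> (pid (G N) <= pid (G M))%O.
  move=> NM; apply/pid_le/pidP; exists (\sum_(n < N) s n).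
  rewrite mulr_sumr; apply: eq_bigr => i _.
  by rewrite Gs // (leq_trans (ltn_ord i)).
have cC : chain C.
  move=> _ _ [N _ <-] [M _ <-].
  by case: (leqP N M) => [|/ltnW] /leG; [left|right].
have [S supS] := supremums_exists C.
(* If [x = G N * y] lies in [pR], then [s n * y = s n * x = 0] for [n < N], and [G N * y] is the sum
   of the [G N * s n * y]. *)
have dS : disj (pid p) S.
  apply: (disj_sup cC supS) => _ [N _ <-] x /(pid_idemP _ pp) px /pidP[y xE].
  have sy n : (n < N)%N -> s n * y = 0.
    move=> nN; have sGn := sG N n nN.
    have : s n * x = s n * y by rewrite xE mulrA sGn.
    by rewrite -px mulrA sp mul0r => <-.
  rewrite xE GE mulr_suml big1 // => i _.
  by rewrite -mulrA sy ?mulr0.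
(* [S + pR] contains each [s n = (s n + a n) - a n], hence also the supremum [T] of the ideals that
   they generate. *)
have [K KE] := pideal_sum S (pid p).
have Ss n : S (s n + a n).
  by rewrite -(Gs n.+1 n) //; apply/pideal_mulr/(supremums_ub supS (GC _))/pid_id.
have pa n : pid p (a n) by apply/(pid_idemP _ pp); case: (pas n).
have Ks n : K (s n).
  apply/KE; exists (s n + a n), (- a n); split => //; last by rewrite addrK.
  exact: pidealN.
have [T supT] := supremums_exists [set pid (s n) | n in setT].
have TK : forall x, T x -> K x.
  by apply: (supremums_sub supT) => _ [n _ <-] x /pidP[y ->]; apply: pideal_mulr.
have Tq x : T x -> q * x = x.
  move=> Tx; apply/(pid_idemP _ qq); move: x Tx; apply: (supremums_sub supT).
  move=> _ [n _ <-] x /pidP[y ->]; apply/(pid_idemP _ qq).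
  by rewrite mulrA; case: (ss n) => _ ->.
have [t [tt qt tq tT]] := idem_gen_le qq Tq.
have ts n : t * s n = s n.
  by apply/tT; apply: (supremums_ub supT (ex_intro2 _ _ n I erefl)); apply: pid_id.
have /TK/KE[g [h [Sg /(pid_idemP _ pp) ph tgh]]] : T t by apply/tT.
exists (- h * t); split; [by nc | by nc |] => n.
apply/eqP; rewrite -subr_eq0; apply/eqP; apply: dS.
  by apply: pidealB => //; apply/(pid_idemP _ pp); have tsn := ts n; nc.
have -> : - h * t * s n - a n = g * s n - (s n + a n).
  have tsn := ts n; have -> : g = t - h by rewrite tgh addrK.
  by nc.
by apply: pidealB; first apply: pideal_mulr.
Qed.

End PrincipalIdeals.

(** * Irreducible regular rings are prime *)

(** The proofs are bundled with the idempotent, so that the ring structure of the corner is inferred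
    from it alone. *)
Record centralIdem (R : pzRingType) := CentralIdem {
  ci_val :> R;
  ci_idem : ci_val * ci_val = ci_val;
  ci_comm : forall x, x * ci_val = ci_val * x;
  ci_neq0 : ci_val != 0
}.

Section Corner.
Variables (R : pzRingType) (e : centralIdem R).

Record corner := Corner { corner_val :> R; _ : ci_val e * corner_val == corner_val }.

HB.instance Definition _ := [isSub for corner_val].
HB.instance Definition _ := [Choice of corner by <:].

Let cornerP (x : corner) : ci_val e * val x = val x.
Proof. exact/eqP/(valP x). Qed.

Fact corner_add_subproof (x y : corner) : ci_val e * (val x + val y) == val x + val y.
Proof. by rewrite mulrDr /= !cornerP. Qed.
Fact corner_opp_subproof (x : corner) : ci_val e * (- val x) == - val x.
Proof. by rewrite mulrN /= cornerP. Qed.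
Fact corner_zero_subproof : ci_val e * 0 == 0.
Proof. by rewrite mulr0. Qed.
Fact corner_mul_subproof (x y : corner) : ci_val e * (val x * val y) == val x * val y.
Proof. by rewrite mulrA /= cornerP. Qed.
Fact corner_one_subproof : ci_val e * ci_val e == ci_val e.
Proof. by rewrite ci_idem. Qed.

Definition corner_add x y := Corner (corner_add_subproof x y).
Definition corner_opp x := Corner (corner_opp_subproof x).
Definition corner_zero := Corner corner_zero_subproof.
Definition corner_mul x y := Corner (corner_mul_subproof x y).
Definition corner_one := Corner corner_one_subproof.

Fact corner_addA : associative corner_add.
Proof. by move=> x y z; apply: val_inj; rewrite /= addrA. Qed.
Fact corner_addC : commutative corner_add.
Proof. by move=> x y; apply: val_inj; rewrite /= addrC. Qed.
Fact corner_add0 : left_id corner_zero corner_add.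
Proof. by move=> x; apply: val_inj; rewrite /= add0r. Qed.
Fact corner_addN : left_inverse corner_zero corner_opp corner_add.
Proof. by move=> x; apply: val_inj; rewrite /= addNr. Qed.

HB.instance Definition _ :=
  GRing.isZmodule.Build corner corner_addA corner_addC corner_add0 corner_addN.

Fact corner_mulA : associative corner_mul.
Proof. by move=> x y z; apply: val_inj; rewrite /= mulrA. Qed.
Fact corner_mul1 : left_id corner_one corner_mul.
Proof. by move=> x; apply: val_inj; rewrite /= cornerP. Qed.
Fact corner_mulr1 : right_id corner_one corner_mul.
Proof. by move=> x; apply: val_inj; rewrite /= ci_comm cornerP. Qed.
Fact corner_mulDl : left_distributive corner_mul +%R.
Proof. by move=> x y z; apply: val_inj; rewrite /= mulrDl. Qed.
Fact corner_mulDr : right_distributive corner_mul +%R.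
Proof. by move=> x y z; apply: val_inj; rewrite /= mulrDr. Qed.
Fact corner_one_neq0 : corner_one != 0.
Proof. by apply/eqP => /(congr1 corner_val) /eqP; rewrite (negPf (ci_neq0 e)). Qed.

HB.instance Definition _ := GRing.Zmodule_isNzRing.Build corner
  corner_mulA corner_mul1 corner_mulr1 corner_mulDl corner_mulDr corner_one_neq0.

Fact corner_proj_subproof (x : R) : ci_val e * (ci_val e * x) == ci_val e * x.
Proof. by rewrite mulrA ci_idem. Qed.
Definition corner_proj x := Corner (corner_proj_subproof x).

End Corner.

(** Otherwise [x] is sent to [(e * x, (1 - e) * x)] by an isomorphism onto a product of two non-zero
    corner rings. *)
Lemma irreducible_central (R : pzRingType) (e : R) : irreducible_ring R ->
  e * e = e -> (forall x, x * e = e * x) -> e = 0 \/ e = 1.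
Proof.
move=> [_ irrR] ee ce; have [->|e0] := eqVneq e 0; first by left.
have [->|e1] := eqVneq e 1; [by right|exfalso].
pose E := CentralIdem ee ce e0.
have ff : (1 - e) * (1 - e) = 1 - e by nc.
have cf x : x * (1 - e) = (1 - e) * x by have cex := ce x; nc.
have f0 : 1 - e != 0 by rewrite subr_eq0 eq_sym.
pose F := CentralIdem ff cf f0.
apply: irrR; exists (corner E), (corner F).
pose f x := (corner_proj E x, corner_proj F x).
have fB : zmod_morphism f.
  by move=> x y; congr pair; apply: val_inj; rewrite /= mulrBr.
have fM : monoid_morphism f.
  split=> [|x y]; first by congr pair; apply: val_inj; rewrite /= mulr1.
  congr pair; apply: val_inj => /=.
    by rewrite [RHS]mulrA -[e * x * e]mulrA ce !mulrA ee.
  by rewrite [RHS]mulrA -[(1 - e) * x * (1 - e)]mulrA cf !mulrA ff.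
pose f1 := GRing.isZmodMorphism.Build R (corner E * corner F)%type f fB.
pose f2 := GRing.isMonoidMorphism.Build R (corner E * corner F)%type f fM.
exists (HB.pack f f1 f2 : {rmorphism R -> (corner E * corner F)%type}).
exists (fun z => corner_val z.1 + corner_val z.2) => [x|[x y]] /=.
  by rewrite mulrBl mul1r addrC subrK.
have /eqP Ex := valP x; have /eqP Fy := valP y; rewrite /= in Ex Fy.
have ey : e * corner_val y = 0 by rewrite -Fy mulrA; nc.
have fx : (1 - e) * corner_val x = 0 by rewrite -Ex mulrA; nc.
congr pair; apply: val_inj; rewrite /= mulrDr.
  by rewrite Ex ey addr0.
by rewrite fx Fy add0r.
Qed.

Section Prime.
Variable R : pzRingType.
Hypothesis R_irreducible : irreducible_ring R.
Hypothesis R_regular : regular_ring R.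
Hypothesis R_complete : complete_lattice (pideal R).

(* The annihilator [{x | a R x = 0}] is the meet of the principal ideals
   [{x | (a r) x = 0}], and it is two-sided, hence generated by a central
   idempotent. *)
Lemma irreducible_prime (a b : R) : a <> 0 -> b <> 0 -> exists r, a * r * b <> 0.
Proof.
move=> a0 b0; apply: contrapT => arb.
have {}arb r : a * r * b = 0.
  by apply: contrapT => ?; apply: arb; exists r.
have annP c : exists I : pideal R, forall x, I x <-> c * x = 0.
  have [c' cc'c] := R_regular c; exists (pid (1 - c' * c)) => x.
  split=> [/pidP[y ->]|cx]; first by rewrite mulrA mulrBr mulr1 mulrA cc'c subrr mul0r.
  by apply/pidP; exists x; rewrite mulrBl mul1r -mulrA cx mulr0 subr0.
have [ann annE] := choice annP.
have [_ [M [lbM ubM]]] := R_complete [set ann (a * r) | r in setT].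
have ME x : M x <-> forall r, a * r * x = 0.
  split=> [Mx r|ax].
    apply/annE; have /pideal_leP := lbM _ (ex_intro2 _ _ r I erefl).
    exact.
  apply/pid_le/ubM => _ [r _ <-]; apply/pideal_leP => z /pidP[y ->].
  by apply/annE; rewrite mulrA ax mul0r.
have [g gg gM] := idem_gen R_regular M.
have Rg x : g * (x * g) = x * g.
  apply/gM/ME => r; rewrite mulrA -(mulrA a).
  by have /gM/ME := gg; apply.
(* [M] is a two-sided ideal, so [(1 - g) * z * g = 0] for all [z]; by regularity [g * x * (1 - g)]
   vanishes. *)
have central x : x * g = g * x.
  have [z] := R_regular (g * x * (1 - g)).
  have gzg := Rg z.
  have -> : g * x * (1 - g) * z * (g * x * (1 - g)) = 0.
    by nc.
  move=> gx0; have := Rg x; have : g * x = g * (x * g).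
    by apply: subr0_eq; rewrite [RHS]gx0; nc.
  by move=> -> ->.
have [g0|g1] := irreducible_central R_irreducible gg central.
  by apply: b0; have /ME/gM := arb; rewrite g0 mul0r => <-.
apply: a0; have /gM/ME/(_ 1) : g * 1 = 1 by rewrite g1 mulr1.
by rewrite !mulr1.
Qed.

End Prime.

(** * Perspectivity *)

(** Murray-von Neumann equivalence: for idempotents, left multiplication by [x] is an isomorphism of
    right modules from [eR] onto [fR], with inverse [y]. *)
Definition eqv (R : pzRingType) (e f : R) := exists x y : R,
  [/\ f * x = x /\ x * e = x, e * y = y /\ y * f = y, y * x = e & x * y = f].

Section Perspectivity.
Variable R : pzRingType.
Hypothesis R_irreducible : irreducible_ring R.
Hypothesis R_regular : regular_ring R.
Hypothesis R_complete : complete_lattice (pideal R).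
Hypothesis R_meetc : meet_continuous (pideal R).
Implicit Types (a b c e f g x y z : R) (A B G I J : pideal R).

Definition sub_sum A B G := forall x, A x -> exists b g, [/\ B b, G g & x = b + g].

Lemma sub_sumS A B G B' G' : sub_sum A B G -> (B <= B')%O -> (G <= G')%O ->
  sub_sum A B' G'.
Proof.
move=> sA /pideal_leP sB /pideal_leP sG x /sA[b [g [Bb Gg ->]]].
by exists b, g; split=> //; [apply: sB | apply: sG].
Qed.

Lemma sub_sum_sup (C : set (pideal R)) S B G : supremums C S ->
  (forall J, C J -> sub_sum J B G) -> sub_sum S B G.
Proof.
move=> supS sC; have [K KE] := pideal_sum R_regular B G.
suff SK : forall x, S x -> K x by move=> x /SK /KE.
apply: (supremums_sub supS) => J CJ y Jy.
exact/KE/(sC J CJ).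
Qed.

(* [G] is an axis of perspectivity between the independent ideals [A], [B]. *)
Definition persp A B G :=
  [/\ disj A B, disj G A, disj G B
    & [/\ sub_sum A G B, sub_sum B G A & sub_sum G A B]].

(** Projection along the axis [G] maps [A] isomorphically onto [B]; [u] and [v] are the projections
    of the generators [a] and [b]. *)
Lemma persp_eqv a b A B G : persp A B G ->
  idempotent_elt a -> (forall x, A x <-> a * x = x) ->
  idempotent_elt b -> (forall x, B x <-> b * x = x) -> eqv a b.
Proof.
move=> [dAB dGA dGB [sA sB sG]] aa aA bb bB.
have [g [u [Gg /bB bu ag]]] := sA a ((aA a).2 aa).
have [h [v [Gh /aA av bh]]] := sB b ((bB b).2 bb).
have ag' : g = a - u by rewrite ag addrK.
have bh' : h = b - v by rewrite bh addrK.
exists (u * a), (v * b).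
have e1 : v * b * (u * a) = a.
  apply/eqP; rewrite -subr_eq0; apply/eqP; apply: dGA.
    have -> : v * b * (u * a) - a = - (g * a + h * (u * a)) by rewrite ag' bh'; nc.
    by apply/pidealN/pidealD; apply: pideal_mulr.
  by apply/aA; nc.
have e2 : u * a * (v * b) = b.
  apply/eqP; rewrite -subr_eq0; apply/eqP; apply: dGB.
    have -> : u * a * (v * b) - b = - (h * b + g * (v * b)) by rewrite ag' bh'; nc.
    by apply/pidealN/pidealD; apply: pideal_mulr.
  by apply/bB; nc.
by split=> //; split; nc.
Qed.

(** Zorn's lemma for triples ordered componentwise; an upper bound of a chain consists of the three
    suprema. *)
Lemma persp_max I J : exists A B G, [/\ persp A B G, (A <= I)%O, (B <= J)%O
  & forall A' B' G', persp A' B' G' -> (A' <= I)%O -> (B' <= J)%O ->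
      (A <= A')%O -> (B <= B')%O -> (G <= G')%O -> A' = A].
Proof.
pose P (t : pideal R * pideal R * pideal R) :=
  [/\ persp t.1.1 t.1.2 t.2, (t.1.1 <= I)%O & (t.1.2 <= J)%O].
pose le (s t : {t | P t}) := [&& ((sval s).1.1 <= (sval t).1.1)%O,
  ((sval s).1.2 <= (sval t).1.2)%O & ((sval s).2 <= (sval t).2)%O].
have [||||[[[A B] G] [pABG AI BJ]] tmax] := @Zorn _ le.
- by move=> t; rewrite /le !lexx.
- move=> r s t /and3P[r1 r2 r3] /and3P[s1 s2 s3].
  by apply/and3P; split; [apply: le_trans s1|apply: le_trans s2|apply: le_trans s3].
- move=> [[[A B] G] p] [[[A' B'] G'] p'] /and3P[/= r1 r2 r3] /and3P[/= s1 s2 s3].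
  by apply: eq_exist; congr (_, _, _); apply/le_anti/andP.
- move=> C totC.
  pose CA := [set (sval t).1.1 | t in C].
  pose CB := [set (sval t).1.2 | t in C].
  pose CG := [set (sval t).2 | t in C].
  have cA : chain CA.
    by move=> _ _ [s Cs <-] [t Ct <-]; case: (totC s t Cs Ct) => /and3P[]; auto.
  have cB : chain CB.
    by move=> _ _ [s Cs <-] [t Ct <-]; case: (totC s t Cs Ct) => /and3P[]; auto.
  have cG : chain CG.
    by move=> _ _ [s Cs <-] [t Ct <-]; case: (totC s t Cs Ct) => /and3P[]; auto.
  have [A supA] := supremums_exists R_complete CA.
  have [B supB] := supremums_exists R_complete CB.
  have [G supG] := supremums_exists R_complete CG.
  have leA t : C t -> ((sval t).1.1 <= A)%O by move=> Ct; apply: supA.1; exists t.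
  have leB t : C t -> ((sval t).1.2 <= B)%O by move=> Ct; apply: supB.1; exists t.
  have leG t : C t -> ((sval t).2 <= G)%O by move=> Ct; apply: supG.1; exists t.
  have disjC (H1 H2 : pideal R) : disj H1 H2 -> disj H2 H1.
    by move=> d x ? ?; apply: d.
  have disjS (H1 H2 H1' H2' : pideal R) : disj H1 H2 -> (H1' <= H1)%O ->
      (H2' <= H2)%O -> disj H1' H2'.
    by move=> d /pideal_leP s1 /pideal_leP s2 x /s1 ? /s2 ?; apply: d.
  (* Upper continuity is applied to one chain at a time. Two members of the chain are then compared
     inside the larger triple. *)
  have dAB : disj A B.
    apply: (disj_sup R_complete R_meetc cB supB) => _ [t Ct <-]; apply: (disjC).
    apply: (disj_sup R_complete R_meetc cA supA) => _ [s Cs <-]; apply: (disjC).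
    case: (totC s t Cs Ct) => /and3P[le1 le2 le3].
      by have [[d _ _ _] _ _] := proj2_sig t; apply: disjS d _ _.
    by have [[d _ _ _] _ _] := proj2_sig s; apply: disjS d _ _.
  have dGA : disj G A.
    apply: (disj_sup R_complete R_meetc cA supA) => _ [t Ct <-]; apply: (disjC).
    apply: (disj_sup R_complete R_meetc cG supG) => _ [s Cs <-]; apply: (disjC).
    case: (totC s t Cs Ct) => /and3P[le1 le2 le3].
      by have [[_ d _ _] _ _] := proj2_sig t; apply: disjS d _ _.
    by have [[_ d _ _] _ _] := proj2_sig s; apply: disjS d _ _.
  have dGB : disj G B.
    apply: (disj_sup R_complete R_meetc cB supB) => _ [t Ct <-]; apply: (disjC).
    apply: (disj_sup R_complete R_meetc cG supG) => _ [s Cs <-]; apply: (disjC).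
    case: (totC s t Cs Ct) => /and3P[le1 le2 le3].
      by have [[_ _ d _] _ _] := proj2_sig t; apply: disjS d _ _.
    by have [[_ _ d _] _ _] := proj2_sig s; apply: disjS d _ _.
  have pS : P (A, B, G).
    split=> /=.
    + split=> //; split.
      * apply: (sub_sum_sup supA) => _ [t Ct <-].
        have [[_ _ _ [s _ _]] _ _] := proj2_sig t.
        by apply: (sub_sumS s); [apply: leG | apply: leB].
      * apply: (sub_sum_sup supB) => _ [t Ct <-].
        have [[_ _ _ [_ s _]] _ _] := proj2_sig t.
        by apply: (sub_sumS s); [apply: leG | apply: leA].
      * apply: (sub_sum_sup supG) => _ [t Ct <-].
        have [[_ _ _ [_ _ s]] _ _] := proj2_sig t.
        by apply: (sub_sumS s); [apply: leA | apply: leB].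
    + by apply: supA.2 => _ [t Ct <-]; have [_ ? _] := proj2_sig t.
    + by apply: supB.2 => _ [t Ct <-]; have [_ _ ?] := proj2_sig t.
  exists (exist _ _ pS) => t Ct; apply/and3P.
  by split; [apply: leA | apply: leB | apply: leG].
exists A, B, G; split=> // A' B' G' p' AI' BJ' lA lB lG.
have P' : P (A', B', G') by [].
have := tmax (exist _ _ P'); rewrite /le /= lA lB lG => /(_ isT) E.
by have [-> _ _] := congr1 sval E.
Qed.

(** Primeness yields isomorphic non-zero right ideals [sR] inside [cR] and [yR] inside [dR]. These
    are added to [A] and [B], and the axis [(s - y)R] is added to [G]. *)
Lemma persp_extend A B G c d : persp A B G -> idempotent_elt c ->
  idempotent_elt d -> orthogonal_elts c d -> c <> 0 -> d <> 0 ->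
  (forall a b, A a -> B b -> (c + d) * (a + b) = a + b -> a + b = 0) ->
  exists A' B' G' s, [/\ persp A' B' G',
    [/\ (A <= A')%O, (B <= B')%O & (G <= G')%O],
    (forall x, A' x -> exists a y, A a /\ x = a + c * y),
    (forall x, B' x -> exists b y, B b /\ x = b + d * y)
    & [/\ A' s, c * s = s & s <> 0]].
Proof.
move=> [dAB dGA dGB [sA sB sG]] cc dd cd c0 d0 ind.
have [r y0] := irreducible_prime R_irreducible R_regular R_complete d0 c0.
(* The idempotent [s = z * y] lies in [cRc] and [y * s = y], so that [y] embeds [sR] into [dR]. *)
pose y := d * r * c; have [z0 yzy] := R_regular y.
pose z := c * z0 * d; pose s := z * y.
have {}yzy : y * (z * y) = y.
  by rewrite -[RHS]yzy /z /y; nc.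
have dy : d * y = y by rewrite /y; nc.
have yc : y * c = y by rewrite /y; nc.
have cz : c * z = z by rewrite /z; nc.
have zd : z * d = z by rewrite /z; nc.
have zs : z * y = s by [].
have ys : y * s = y by [].
clearbody s.
have cs : c * s = s by rewrite -zs; nc.
have ds : d * s = 0 by rewrite -cs mulrA (proj2 cd) mul0r.
have cy : c * y = 0 by rewrite -dy mulrA (proj1 cd) mul0r.
have ss : s * s = s by rewrite -{1}zs -mulrA ys.
have s0 : s <> 0 by move=> s0; apply: y0; rewrite -/y -ys s0 mulr0.
clearbody y z; clear r y0 z0.
(* [(c + d)R] is independent of [A + B], and [A] of [B]; this reduces the three disjointness claims
   to the old ones. *)
have ind' a b u : A a -> B b -> a + b = (c + d) * u -> a = 0 /\ b = 0.
  move=> Aa Bb abu; have ab0 : a + b = 0 by apply: ind => //; rewrite abu; nc.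
  have ba : b = - a by apply/eqP; rewrite -addr_eq0 addrC ab0.
  have a0 : a = 0 by apply: dAB => //; rewrite -[a]opprK -ba; apply: pidealN.
  by rewrite ba a0 oppr0.
have [A' A'E] := pideal_sum R_regular A (pid s).
have [B' B'E] := pideal_sum R_regular B (pid y).
have [G' G'E] := pideal_sum R_regular G (pid (s - y)).
have inl (I1 I2 I3 : pideal R) : (forall x, I3 x <->
    exists a b, [/\ I1 a, I2 b & x = a + b]) -> (I1 <= I3)%O /\ (I2 <= I3)%O.
  move=> E; split; apply/pideal_leP => x Ix; apply/E.
    by exists x, 0; split; rewrite ?addr0 //; apply: pideal0.
  by exists 0, x; split; rewrite ?add0r //; apply: pideal0.
have [leA /pid_le sA'] := inl _ _ _ A'E; have [leB /pid_le yB'] := inl _ _ _ B'E.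
have [leG /pid_le sG'] := inl _ _ _ G'E.
have ssum (H1 H2 H3 : pideal R) (u v w : R) : sub_sum H1 H2 H3 -> H2 u -> H3 v ->
    w = u + v -> forall H1' : pideal R,
    (forall x, H1' x <-> exists a b, [/\ H1 a, pid w b & x = a + b]) ->
    sub_sum H1' H2 H3.
  move=> sH Hu Hv wE H1' E x /E[a [b [/sH[a1 [a2 [Ha1 Ha2 ->]]] /pidP[k ->] ->]]].
  exists (a1 + u * k), (a2 + v * k).
  split; [apply: pidealD => //; exact: pideal_mulr |
          apply: pidealD => //; exact: pideal_mulr |].
  by rewrite wE mulrDl addrACA.
exists A', B', G', s; split=> //.
- split.
  + move=> x /A'E[a [_ [Aa /pidP[u ->] xE]]] /B'E[b [_ [Bb /pidP[v ->] xE']]].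
    have [a0 b0] : a = 0 /\ - b = 0.
      apply: (ind' a (- b) (y * v - s * u)) => //; first exact: pidealN.
      have -> : a = x - s * u by rewrite xE addrK.
      by have -> : b = x - y * v by [rewrite xE' addrK]; nc.
    have yv : y * v = x by rewrite xE' -[b]opprK b0 oppr0 add0r.
    have <- : c * x = x by rewrite xE a0; nc.
    by rewrite -yv mulrA cy mul0r.
  + move=> x /G'E[g [_ [Gg /pidP[u ->] xE]]] /A'E[a [_ [Aa /pidP[v ->] xE']]].
    have [a1 [b1 [Aa1 Bb1 gE]]] := sG g Gg.
    have [a10 b10] : a1 - a = 0 /\ b1 = 0.
      apply: (ind' _ _ (s * v - (s - y) * u)) => //; first exact: pidealB.
      have -> : a1 = g - b1 by rewrite gE addrK.
      have -> : a = x - s * v by rewrite xE' addrK.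
      by have -> : g = x - (s - y) * u by [rewrite xE addrK]; nc.
    have g0 : g = 0.
      by apply: dGA => //; rewrite gE b10 addr0 -[a1](subrK a) a10 add0r.
    have a0 : a = 0.
      by rewrite -(subr0_eq a10) -[RHS]g0 gE b10 addr0.
    have yu0 : y * u = 0.
      have : d * x = 0 by rewrite xE' a0; nc.
      by rewrite xE g0; move=> dx; rewrite -[LHS]opprK -[RHS]oppr0 -dx; nc.
    have su0 : s * u = 0 by rewrite -zs -mulrA yu0 mulr0.
    by rewrite xE g0; nc.
  + move=> x /G'E[g [_ [Gg /pidP[u ->] xE]]] /B'E[b [_ [Bb /pidP[v ->] xE']]].
    have [a1 [b1 [Aa1 Bb1 gE]]] := sG g Gg.
    have [a10 b10] : a1 = 0 /\ b1 - b = 0.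
      apply: (ind' _ _ (y * v - (s - y) * u)) => //; first exact: pidealB.
      have -> : b1 = g - a1 by rewrite gE addrC addKr.
      have -> : b = x - y * v by rewrite xE' addrK.
      by have -> : g = x - (s - y) * u by [rewrite xE addrK]; nc.
    have g0 : g = 0.
      by apply: dGB => //; rewrite gE a10 add0r -[b1](subrK b) b10 add0r.
    have b0 : b = 0.
      by rewrite -(subr0_eq b10) -[RHS]g0 gE a10 add0r.
    have su0 : s * u = 0.
      have : c * x = 0 by rewrite xE' b0; nc.
      by rewrite xE g0; move=> dx; rewrite -[RHS]dx; nc.
    have yu0 : y * u = 0 by rewrite -ys -mulrA su0 mulr0.
    by rewrite xE g0; nc.
  + split.
    * apply: (ssum _ _ _ (s - y) y _ _ sG' yB' _ _ A'E); last by rewrite subrK.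
      exact: sub_sumS sA leG leB.
    * apply: (ssum _ _ _ (- (s - y)) s _ _ _ sA' _ _ B'E).
      - exact: sub_sumS sB leG leA.
      - exact: pidealN.
      - by rewrite opprB subrK.
    * apply: (ssum _ _ _ s (- y) _ _ sA' _ _ _ G'E) => //; last exact: pidealN.
      exact: sub_sumS sG leA leB.
- move=> x /A'E[a [_ [Aa /pidP[u ->] ->]]]; exists a, (s * u); split=> //.
  by rewrite mulrA cs.
- move=> x /B'E[b [_ [Bb /pidP[u ->] ->]]]; exists b, (y * u); split=> //.
  by rewrite mulrA dy.
Qed.

End Perspectivity.

(** * Rank, equivalence and halving *)

Section Rank.
Variables (K : realType) (R : pzRingType) (rk : R -> K).
Hypothesis rkP : rank_function rk.
Implicit Types a b c e f x y : R.

Lemma rank_ge0 a : 0 <= rk a.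
Proof. by case: rkP => /(_ a) /andP[]. Qed.

Lemma rank_le1 a : rk a <= 1.
Proof. by case: rkP => /(_ a) /andP[]. Qed.

Lemma rank_mull a b : rk (a * b) <= rk a.
Proof. by case: rkP => _ _ /(_ a b); rewrite le_min => /andP[]. Qed.

Lemma rank_mulr a b : rk (a * b) <= rk b.
Proof. by case: rkP => _ _ /(_ a b); rewrite le_min => /andP[]. Qed.

Lemma rank_orthD e f : idempotent_elt e -> idempotent_elt f ->
  orthogonal_elts e f -> rk (e + f) = rk e + rk f.
Proof. by case: rkP => _ _ _ + _; apply. Qed.

Lemma rank0 : rk 0 = 0.
Proof.
have := @rank_orthD 0 0; rewrite /idempotent_elt /orthogonal_elts !mulr0 addr0.
by move/(_ erefl erefl (conj erefl erefl)); lra.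
Qed.

Lemma rank_eq0 a : rk a = 0 -> a = 0.
Proof.
case: rkP => _ _ _ _ pos a0; apply: contrapT => /pos.
by rewrite a0 ltxx.
Qed.

Lemma rank_subidem e f : idempotent_elt e -> idempotent_elt f ->
  e * f = f -> f * e = f -> rk e = rk f + rk (e - f).
Proof.
move=> ee ff ef fe; rewrite -rank_orthD ?(addrC f) ?subrK //; first by nc.
by split; nc.
Qed.

Lemma eqv_rank e f : idempotent_elt e -> idempotent_elt f -> eqv e f ->
  rk e = rk f.
Proof.
move=> ee ff [x [y [[fx xe] [ey yf] yx xy]]]; apply/eqP; rewrite eq_le.
apply/andP; split.
  have -> : e = y * f * x by nc.
  by apply: le_trans (rank_mull _ _) _; apply: rank_mulr.
have -> : f = x * e * y by nc.
by apply: le_trans (rank_mull _ _) _; apply: rank_mulr.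
Qed.

Hypothesis R_irreducible : irreducible_ring R.
Hypothesis R_regular : regular_ring R.
Hypothesis R_complete : complete_lattice (pideal R).
Hypothesis R_meetc : meet_continuous (pideal R).

(** A maximal perspectivity between parts of [eR] and [fR] leaves complements [e - a] and [f - b] of
    equal rank. If they were not zero, [persp_extend] would enlarge the first part by a non-zero
    element of [(e - a)R]. *)
Lemma rank_eqv e f : idempotent_elt e -> idempotent_elt f ->
  orthogonal_elts e f -> rk e = rk f -> eqv e f.
Proof.
move=> ee ff ef rkef.
have [A [B [G [pABG Ae Bf maxA]]]] :=
  persp_max R_regular R_complete R_meetc (pid e) (pid f).
have AP x : A x -> e * x = x.
  by move=> Ax; apply/(pid_idemP _ ee); move/pideal_leP: Ae; apply.
have BP x : B x -> f * x = x.
  by move=> Bx; apply/(pid_idemP _ ff); move/pideal_leP: Bf; apply.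
have [a [aa ea ae aA]] := idem_gen_le R_regular ee AP.
have [b [bb fb bf bB]] := idem_gen_le R_regular ff BP.
have ab : eqv a b := persp_eqv pABG aa aA bb bB.
have rab := eqv_rank aa bb ab.
have re := rank_subidem ee aa ea ae; have rf := rank_subidem ff bb fb bf.
suff /rank_eq0 ea0 : rk (e - a) = 0.
  have /rank_eq0 fb0 : rk (f - b) = 0 by move: ea0 re rf => ->; rewrite rank0; lra.
  by rewrite (subr0_eq ea0) (subr0_eq fb0).
have [->|c0] := pselect (e - a = 0); first exact: rank0.
have [d0|d0] := pselect (f - b = 0).
  by move: rf; rewrite d0 rank0; have := rank_ge0 (e - a); lra.
have [||||A' [B' [G' [s [p' [lA lB lG] A'E B'E [As cs s0]]]]]] :=
  persp_extend R_irreducible R_regular R_complete pABG _ _ _ c0 d0.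
- by nc.
- by nc.
- have [ef0 fe0] := ef; split.
    apply: (mulr_eq0_sub (e := e) (f := f)) ef0; nc.
  by apply: (mulr_eq0_sub (e := f) (f := e)) fe0; nc.
- move=> x y /aA ax /bB byy <-; have [ef0 fe0] := ef.
  have fx : f * x = 0 by rewrite -ax -ea !mulrA fe0 !mul0r.
  have ey : e * y = 0 by rewrite -byy -fb !mulrA ef0 !mul0r.
  have bx : b * x = 0 by rewrite -bf -mulrA fx mulr0.
  have ay : a * y = 0 by rewrite -ae -mulrA ey mulr0.
  have ex : e * x = x by rewrite -ax mulrA ea.
  have fy : f * y = y by rewrite -byy mulrA fb.
  by nc.
have A'e : (A' <= pid e)%O.
  apply/pideal_leP => _ /A'E[x [y [/AP ex ->]]]; apply/(pid_idemP _ ee).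
  by rewrite mulrDr ex; nc.
have B'f : (B' <= pid f)%O.
  apply/pideal_leP => _ /B'E[x [y [/BP fx ->]]]; apply/(pid_idemP _ ff).
  by rewrite mulrDr fx; nc.
have A'A := maxA _ _ _ p' A'e B'f lA lB lG.
move: As; rewrite A'A => /aA as_; case: s0.
by rewrite -cs -as_ mulrA mulrBl ea aa subrr mul0r.
Qed.

Hypothesis R_nondiscrete : ~ rank_discrete rk.

(** Otherwise every ball of radius [r] is a single point and the topology is discrete. *)
Lemma small_rank (r : K) : 0 < r -> exists2 x, x <> 0 & rk x < r.
Proof.
move=> r0; apply: contrapT => small; apply: R_nondiscrete => U a Ua.
exists r => // b /= rab; suff -> : b = a by [].
apply: contrapT => ba; apply: small; exists (a - b) => //.
by move=> /subr0_eq ab; apply: ba.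
Qed.

(** By primeness some [y = e * r * x] is non-zero, where [x] has smaller rank than [e]; then [yR] is
    a proper non-zero part of [eR]. *)
Lemma no_minimal_idem e : idempotent_elt e -> e <> 0 ->
  exists c, [/\ idempotent_elt c, e * c = c, c * e = c, c <> 0 & c <> e].
Proof.
move=> ee e0; have re : 0 < rk e by case: rkP => _ _ _ _; apply.
have [x x0 rx] := small_rank re.
have [r y0] := irreducible_prime R_irreducible R_regular R_complete e0 x0.
set y := e * r * x in y0; have [z yzy] := R_regular y.
have ey : e * y = y by rewrite /y; nc.
have ry : rk y < rk e by apply: le_lt_trans rx; apply: rank_mulr.
clearbody y; exists (y * z * e).
have yzy' : y * (z * y) = y by rewrite mulrA.
have cy : y * z * e * y = y by nc.
split; [by nc | by nc | by nc | |] => cE; first by apply: y0; rewrite -cy cE mul0r.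
by move: ry; rewrite -cE -mulrA ltNge rank_mull.
Qed.

(** A maximal perspectivity between two parts [A], [B] of [eR] exhausts [eR]: a non-zero complement
    would split into two orthogonal non-zero idempotents, to which [persp_extend] applies. *)
Lemma halve e : idempotent_elt e -> exists e1 e2, [/\ idempotent_elt e1,
  idempotent_elt e2, orthogonal_elts e1 e2, e = e1 + e2 & rk e1 = rk e2].
Proof.
move=> ee; have [A [B [G [pABG Ae Be maxA]]]] :=
  persp_max R_regular R_complete R_meetc (pid e) (pid e).
have AP x : A x -> e * x = x.
  by move=> Ax; apply/(pid_idemP _ ee); move/pideal_leP: Ae; apply.
have BP x : B x -> e * x = x.
  by move=> Bx; apply/(pid_idemP _ ee); move/pideal_leP: Be; apply.
have [S SE] := pideal_sum R_regular A B.
have [s [ss es se sS]] : exists s, [/\ idempotent_elt s, e * s = s, s * e = s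
    & forall x, S x <-> s * x = x].
  apply: idem_gen_le => // _ /SE[a [b [/AP ea /BP eb ->]]].
  by rewrite mulrDr ea eb.
have e_s : e = s.
  apply: subr0_eq; apply: contrapT => c0.
  have cc : idempotent_elt (e - s) by nc.
  have [c1 [c1c1 cc1 c1c c10 c1c_]] := no_minimal_idem cc c0.
  have d0 : e - s - c1 <> 0 by move=> /subr0_eq cE; apply: c1c_.
  have sc : s * (e - s) = 0 by nc.
  have cs : (e - s) * s = 0 by nc.
  have ec : e * (e - s) = e - s by nc.
  have c1s : c1 * s = 0 by rewrite -c1c -mulrA cs mulr0.
  have sc1 : s * c1 = 0 by rewrite -cc1 mulrA sc mul0r.
  have ec1 : e * c1 = c1 by rewrite -cc1 mulrA ec.
  have c1e : c1 * e = c1 by move: c1c; rewrite mulrBr c1s subr0.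
  have [|||A' [B' [G' [t [p' [lA lB lG] A'E B'E [At ct t0]]]]]] :=
    persp_extend R_irreducible R_regular R_complete pABG c1c1 _ _ c10 d0.
  - by nc.
  - by split; nc.
  - move=> a b Aa Bb <-.
    have /sS sab : S (a + b) by apply/SE; exists a, b.
    by rewrite -sab mulrA [c1 + _]addrC subrK cs mul0r.
  have A'e : (A' <= pid e)%O.
    apply/pideal_leP => _ /A'E[x [y [/AP ex ->]]]; apply/(pid_idemP _ ee).
    by rewrite mulrDr ex; nc.
  have B'e : (B' <= pid e)%O.
    apply/pideal_leP => _ /B'E[x [y [/BP fx ->]]]; apply/(pid_idemP _ ee).
    by rewrite mulrDr fx; nc.
  have A'A := maxA _ _ _ p' A'e B'e lA lB lG.
  move: At; rewrite A'A => At; apply: t0.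
  have /sS st : S t.
    by apply/SE; exists t, 0; split; rewrite ?addr0 //; apply: pideal0.
  by rewrite -ct -st mulrA c1s mul0r.
(* The components of [e] in the direct sum of [A] and [B] are the projections onto the two
   summands. *)
have /SE[a [b [Aa Bb eab]]] : S e by apply/sS; rewrite -e_s.
have [dAB _ _ _] := pABG.
have aA x : A x -> a * x = x /\ b * x = 0.
  move=> Ax; have bx : b * x = 0.
    apply: dAB; last exact: pideal_mulr.
    have -> : b * x = x - a * x
      by apply/eqP; rewrite eq_sym subr_eq -mulrDl addrC -eab AP.
    by apply: pidealB => //; apply: pideal_mulr.
  by split=> //; rewrite -{2}(AP x Ax) eab mulrDl bx addr0.
have bB x : B x -> b * x = x /\ a * x = 0.
  move=> Bx; have ax : a * x = 0.
    apply: dAB; first exact: pideal_mulr.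
    have -> : a * x = x - b * x
      by apply/eqP; rewrite eq_sym subr_eq -mulrDl -eab BP.
    by apply: pidealB => //; apply: pideal_mulr.
  by split=> //; rewrite -{2}(BP x Bx) eab mulrDl ax add0r.
have [aa ba] := aA a Aa; have [bb ab] := bB b Bb.
exists a, b; split=> //; apply: eqv_rank => //.
apply: (persp_eqv pABG) => // x; split.
- by case/aA.
- by move=> <-; apply: pideal_mulr.
- by case/bB.
- by move=> <-; apply: pideal_mulr.
Qed.

End Rank.

(** * Products of transvections *)

Section Transvections.
Variable R : pzRingType.
Implicit Types a b c d e f g p q s t u v w x y z : R.

(** For idempotents [p] and [q] this is the Peirce component [pRq]. *)
Definition peirce p q a := p * a = a /\ a * q = a.

(** Transvections are counted in pairs, one from each side. A single one is a pair whose other entry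
    is [0]. *)
Fixpoint elem k p q x : Prop :=
  if k is k'.+1 then
    exists a b y, [/\ peirce p q a, peirce q p b, elem k' p q y
                    & x = (1 + a) * (1 + b) * y]
  else x = 1.

Lemma peirce0 p q : peirce p q 0.
Proof. by split; rewrite ?mulr0 ?mul0r. Qed.

Lemma peirceN p q a : peirce p q a -> peirce p q (- a).
Proof. by case=> pa aq; split; rewrite ?mulrN ?mulNr ?pa ?aq. Qed.

Lemma elem1 p q a b : peirce p q a -> peirce q p b ->
  elem 1 p q ((1 + a) * (1 + b)).
Proof. by move=> pa pb; exists a, b, 1; rewrite mulr1. Qed.

Lemma elem_mul k l p q x y : elem k p q x -> elem l p q y ->
  elem (k + l) p q (x * y).
Proof.
elim: k x => [x ->|k IHk x [a [b [z [pa pb ez ->]]]] ey]; first by rewrite mul1r.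
by exists a, b, (z * y); split=> //; [apply: IHk | rewrite -!mulrA].
Qed.

(* [t], [t'] are mutually inverse units acting as the identity off [e]. *)
Definition lunit e t t' :=
  [/\ t * t' = 1, t' * t = 1, t * (1 - e) = 1 - e & (1 - e) * t = 1 - e].

Lemma lunit_sym e t t' : lunit e t t' -> lunit e t' t.
Proof.
move=> [tt' t't te et]; split=> //; first by rewrite -{1}te mulrA t't mul1r.
by rewrite -{1}et -mulrA tt' mulr1.
Qed.

Lemma lunit_fixl e t t' x : lunit e t t' -> e * x = 0 -> t * x = x.
Proof.
move=> [_ _ te _] ex; have xE : (1 - e) * x = x by rewrite mulrBl mul1r ex subr0.
by rewrite -{1}xE mulrA te xE.
Qed.

Lemma lunit_fixr e t t' x : lunit e t t' -> x * e = 0 -> x * t = x.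
Proof.
move=> [_ _ _ et] ex; have xE : x * (1 - e) = x by rewrite mulrBr mulr1 ex subr0.
by rewrite -{1}xE -mulrA et xE.
Qed.

(** In this form the triviality of [t] off [e] is a rewriting rule for [nc]. *)
Lemma lunit_idl e t t' : lunit e t t' -> e * t = t - 1 + e.
Proof.
move=> [_ _ _]; rewrite mulrBl mul1r => /eqP.
rewrite subr_eq addrC -subr_eq => /eqP <-.
by rewrite opprB [e - 1]addrC addrA.
Qed.

Lemma lunit_idr e t t' : lunit e t t' -> t * e = t - 1 + e.
Proof.
move=> [_ _ + _]; rewrite mulrBr mulr1 => /eqP.
rewrite subr_eq addrC -subr_eq => /eqP <-.
by rewrite opprB [e - 1]addrC addrA.
Qed.

Lemma lunit_stable e t t' : idempotent_elt e -> lunit e t t' ->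
  e * (t * e) = t * e.
Proof. by move=> ee tU; have l := lunit_idl tU; rewrite (lunit_idr tU); nc. Qed.

Lemma lunit_mul e s s' t t' : lunit e s s' -> lunit e t t' ->
  lunit e (s * t) (t' * s').
Proof.
move=> [ss' s's se es] [tt' t't te et]; split.
- by rewrite -mulrA (mulrA t) tt' mul1r.
- by rewrite -mulrA (mulrA s') s's mul1r.
- by rewrite -mulrA te.
- by rewrite mulrA es.
Qed.

Lemma lunit_sub e f t t' : lunit e t t' -> f * e = e -> e * f = e ->
  lunit f t t'.
Proof.
move=> tE fe ef; have [tt' t't _ _] := tE; split=> //.
  by apply: (lunit_fixl tE); rewrite mulrBr mulr1 ef subrr.
by apply: (lunit_fixr tE); rewrite mulrBl mul1r fe subrr.
Qed.

Lemma lunit_restrict f g t t' : lunit (f + g) t t' -> t * f = f -> f * t = f ->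
  lunit g t t'.
Proof.
move=> [tt' t't te et] tf ft.
have gE : 1 - g = 1 - (f + g) + f by nc.
by split=> //; rewrite gE; [rewrite mulrDr te tf | rewrite mulrDl et ft].
Qed.

Lemma lunit_transvection e p q a : e * p = p -> q * e = q -> q * p = 0 ->
  peirce p q a -> lunit e (1 + a) (1 - a).
Proof.
move=> ep qe qp [pa aq].
have aa : a * a = 0 by rewrite -{2}pa mulrA -aq -(mulrA a) qp mulr0 mul0r.
have ea : e * a = a by rewrite -pa mulrA ep.
have ae : a * e = a by rewrite -aq -mulrA qe.
by split; nc.
Qed.

(** The equivalence carries [v] from the corner of [f] to that of [g]; the summand [1 - g] extends
    it by the identity. *)
Lemma lunit_copy f g x y v v' : idempotent_elt f -> idempotent_elt g ->
  peirce g f x -> peirce f g y -> y * x = f -> x * y = g -> lunit f v v' ->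
  lunit g (1 - g + x * v * y) (1 - g + x * v' * y).
Proof.
move=> ff gg [gx xf] [fy yg] yx xy vf.
have [vv' v'v _ _] := vf.
have h1 := lunit_idl vf; have h2 := lunit_idr vf.
have h3 := lunit_idl (lunit_sym vf); have h4 := lunit_idr (lunit_sym vf).
by clear vf; split; nc.
Qed.

(** Whitehead's lemma: diag(v, v^-1) is a product of elementary matrices, with [x] and [y] as matrix
    units. *)
Lemma elem_diag f g x y v v' : idempotent_elt f -> idempotent_elt g ->
  orthogonal_elts f g ->
  peirce g f x -> peirce f g y -> y * x = f -> x * y = g -> lunit f v v' ->
  elem 3 f g (v * (1 - g + x * v' * y)).
Proof.
move=> ff gg [fg gf] [gx xf] [fy yg] yx xy vf.
have [vv' v'v _ _] := vf.
have h1 := lunit_idl vf; have h2 := lunit_idr vf.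
have h3 := lunit_idl (lunit_sym vf); have h4 := lunit_idr (lunit_sym vf).
have vg := lunit_fixl vf fg; have gv := lunit_fixr vf gf.
have v'g := lunit_fixl (lunit_sym vf) fg.
have gv' := lunit_fixr (lunit_sym vf) gf.
have xx : x * x = 0 by apply: mulr_eq0_sub xf gx fg.
have yy : y * y = 0 by apply: mulr_eq0_sub yg fy gf.
have vx : v * x = x by apply: (lunit_fixl vf); rewrite -gx mulrA fg mul0r.
have v'x : v' * x = x.
  by apply: (lunit_fixl (lunit_sym vf)); rewrite -gx mulrA fg mul0r.
have yv : y * v = y by apply: (lunit_fixr vf); rewrite -yg -mulrA gf mulr0.
have yv' : y * v' = y.
  by apply: (lunit_fixr (lunit_sym vf)); rewrite -yg -mulrA gf mulr0.
have fx : f * x = 0 by rewrite -gx mulrA fg mul0r.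
have gy : g * y = 0 by rewrite -fy mulrA gf mul0r.
have yf : y * f = 0 by rewrite -yg -mulrA gf mulr0.
have xg : x * g = 0 by rewrite -xf -mulrA fg mulr0.
clear vf.
(* Of the six factors in Whitehead's identity, the adjacent [1 + v * y] and [1 - y] merge. The
   remaining five make three pairs, the last one completed by [1 + 0]. *)
exists (v * y), (- (x * v')), ((1 + (v * y - y)) * (1 + x) * ((1 + - y) * (1 + 0))).
split; [by split; nc | by split; nc | | by nc].
by apply: (@elem_mul 1 1); apply: elem1; split; nc.
Qed.

End Transvections.

(** * Stable range and reduction of a unit to half of its support *)

Section Reduction.
Variables (K : realType) (R : pzRingType) (rk : R -> K).
Hypothesis rkP : rank_function rk.
Hypothesis R_irreducible : irreducible_ring R.
Hypothesis R_regular : regular_ring R.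
Hypothesis R_complete : complete_lattice (pideal R).
Hypothesis R_meetc : meet_continuous (pideal R).
Implicit Types a b c d e f g x y z : R.

(* The kernel [k] and the cokernel [k'] of [d] have the same rank, and [b]
   embeds [k] into [g], where it becomes orthogonal to [k']. *)
Lemma stable_range f g d b x y : idempotent_elt f -> idempotent_elt g ->
  orthogonal_elts f g -> peirce f f d -> peirce g f b -> peirce f g y ->
  x * d + y * b = f ->
  exists z w', [/\ peirce f g z, peirce f f w', (d + z * b) * w' = f
                 & w' * (d + z * b) = f].
Proof.
move=> ff gg fg [fd df] [gb bf] [fy yg] xdyb.
have [d0 dd0d] := R_regular d.
(* The quasi-inverse [d0] is replaced by a reflexive one, [d1], inside [fRf]. *)
have {}dd0d : d * (d0 * d) = d by rewrite mulrA.
pose d1 : R := f * d0 * d * d0 * f.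
have fd1 : f * d1 = d1 by rewrite /d1; nc.
have d1f : d1 * f = d1 by rewrite /d1; nc.
have dd1d : d * (d1 * d) = d by rewrite /d1; nc.
have d1dd1 : d1 * (d * d1) = d1 by rewrite /d1; nc.
clearbody d1; clear dd0d d0.
pose k : R := f - d1 * d; pose k' : R := f - d * d1.
have kk : idempotent_elt k by rewrite /k; nc.
have kk' : idempotent_elt k' by rewrite /k'; nc.
have fk : f * k = k by rewrite /k; nc.
have kf : k * f = k by rewrite /k; nc.
have fk' : f * k' = k' by rewrite /k'; nc.
have kf' : k' * f = k' by rewrite /k'; nc.
have dk : d * k = 0 by rewrite /k; nc.
have kd' : k' * d = 0 by rewrite /k'; nc.
have kd1 : k * d1 = 0 by rewrite /k; nc.
have dk1' : d1 * k' = 0 by rewrite /k'; nc.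
have rkk : rk k = rk k'.
  have i1 : idempotent_elt (d1 * d) by nc.
  have i2 : idempotent_elt (d * d1) by nc.
  have r12 : rk (d1 * d) = rk (d * d1).
    by apply: (eqv_rank rkP) => //; exists d, d1; split=> //; split; nc.
  have r1 : rk f = rk (d1 * d) + rk k.
    by apply: (rank_subidem rkP) => //; nc.
  have r2 : rk f = rk (d * d1) + rk k'.
    by apply: (rank_subidem rkP) => //; nc.
  by lra.
have kE : d1 * d = f - k by rewrite /k opprB addrC subrK.
have kE' : d * d1 = f - k' by rewrite /k' opprB addrC subrK.
clearbody k k'.
have ybk : y * (b * k) = k.
  have : (x * d + y * b) * k = f * k by rewrite xdyb.
  by rewrite mulrDl -!mulrA dk fk mulr0 add0r.
(* As [y * b * k = k], this is an idempotent of [gRg] equivalent to [k]. *)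
pose l : R := b * k * y.
have ll : idempotent_elt l by rewrite /l; nc.
have gl : g * l = l by rewrite /l; nc.
have lg : l * g = l by rewrite /l; nc.
have kl : rk k = rk l.
  apply: (eqv_rank rkP) => //; exists (b * k), (k * y).
  by rewrite /l; split; [split; nc | split; nc | nc | nc].
have lk' : orthogonal_elts l k'.
  have [fg0 gf0] := fg.
  by split; [apply: mulr_eq0_sub lg fk' gf0 | apply: mulr_eq0_sub kf' gl fg0].
have rlk : rk l = rk k' by rewrite -kl.
have [z [z' [[k'z zl] [lz' z'k'] z'z zz']]] := rank_eqv rkP R_irreducible R_regular
  R_complete R_meetc ll kk' lk' rlk.
have fz : f * z = z by rewrite -k'z mulrA fk'.
have zg : z * g = z by rewrite -zl -mulrA lg.
have zbky : z * (b * (k * y)) = z by rewrite -[RHS]zl /l; nc.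
have d1z : d1 * z = 0 by rewrite -k'z mulrA dk1' mul0r.
have z'd : z' * d = 0 by rewrite -z'k' -mulrA kd' mulr0.
have z'f : z' * f = z' by rewrite -z'k' -mulrA kf'.
have kyz'z : y * (l * (b * k)) = k by rewrite /l; nc.
have {}kyz'z : k * (y * (z' * (z * (b * k)))) = k.
  by rewrite (mulrA z') z'z kyz'z kk.
have dk0 u : d * (k * u) = 0 by rewrite mulrA dk mul0r.
clear kl rlk rkk lk'; clearbody l.
(* [d + z * b] is block triangular: [d1] inverts [d] between the complements of [k] and [k'], while
   [k * y * z'] inverts [z * b] from [k] to [k']. The last term corrects the off-diagonal block. *)
exists z, (d1 + k * y * z' - k * y * z' * z * b * d1).
split; first by [].
- by split; nc.
- by nc.
pose m : R := k * (y * z').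
have mzbk : m * (z * (b * k)) = k by rewrite /m -!mulrA.
have md : m * d = 0 by rewrite /m -!mulrA z'd !mulr0.
have -> : k * y * z' = m by rewrite /m mulrA.
by clearbody m; nc.
Qed.

(** Gaussian elimination on 2 x 2 matrices over [f] and [g]. A first transvection makes the
    [f]-entry an invertible [w], two more clear its column and its row, and [elem_diag] shifts [w]
    to [g]. *)
Lemma elem_reduction f g t t' : idempotent_elt f -> idempotent_elt g ->
  orthogonal_elts f g -> eqv f g -> lunit (f + g) t t' ->
  exists x s s', [/\ elem 5 f g x, lunit g s s' & t = x * s].
Proof.
move=> ff gg fg [al [be [[gal alf] [fbe beg] beal albe]]] tU.
have [tt' t't _ _] := tU.
have fgf : (f + g) * f = f by nc.
have fgg : (f + g) * g = g by nc.
have ffg : f * (f + g) = f by nc.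
have gfg : g * (f + g) = g by nc.
have [fg0 gf0] := fg.
have lt := lunit_idl tU.
have [z [w' [[fz zg] [fw' w'f] ww' w'w]]] : exists z w', [/\ peirce f g z,
    peirce f f w', (f * t * f + z * (g * t * f)) * w' = f
    & w' * (f * t * f + z * (g * t * f)) = f].
  (* The first row of [t'] times the first column of [t] is [f]. *)
  apply: (@stable_range f g _ _ (f * t' * f) (f * t' * g)) => //; try by split; nc.
  have -> : f * t' * f * (f * t * f) + f * t' * g * (g * t * f)
          = f * t' * ((f + g) * t) * f by nc.
  by rewrite lt; nc.
set w : R := f * t * f + z * (g * t * f) in ww' w'w.
have fw : f * w = w by rewrite /w; nc.
have wf : w * f = w by rewrite /w; nc.
pose b : R := g * t * f; pose t1 : R := (1 + z) * t.
have zU : lunit (f + g) (1 + z) (1 - z) by apply: (lunit_transvection fgf gfg gf0).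
have t1U : lunit (f + g) t1 (t' * (1 - z)) := lunit_mul zU tU.
have ft1f : f * (t1 * f) = w.
  by rewrite /t1 /w -{2}zg; nc.
have gt1f : g * (t1 * f) = b.
  by rewrite /t1 /b -{1}fz; nc.
have bf : b * f = b by rewrite /b; nc.
have gb : g * b = b by rewrite /b; nc.
have t1E : t = (1 - z) * t1 by have [_ zz _ _] := zU; rewrite /t1 mulrA zz mul1r.
clearbody b t1.
have pb : peirce g f (b * w') by split; [rewrite mulrA gb | rewrite -mulrA w'f].
have bU : lunit (f + g) (1 + - (b * w')) (1 - - (b * w')).
  exact: (lunit_transvection fgg ffg fg0 (peirceN pb)).
have bt1U := lunit_mul bU t1U.
pose t2 : R := (1 + - (b * w')) * t1.
have t2E : t1 = (1 + b * w') * t2.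
  have [_ + _ _] := bU; rewrite opprK => bb.
  by rewrite /t2 mulrA bb mul1r.
have [t2' t2U] : exists t2', lunit (f + g) t2 t2'.
  by exists (t' * (1 - z) * (1 - - (b * w'))).
have gb' : f * (b * w') = 0 by rewrite -gb !mulrA fg0 !mul0r.
have ft2f : f * (t2 * f) = w.
  rewrite -ft1f /t2 -(mulrA _ t1 f) mulrA.
  by rewrite mulrDr mulr1 mulrN gb' oppr0 addr0.
have gt2f : g * (t2 * f) = 0.
  have bw : b * w' * (t1 * f) = b.
    by rewrite -w'f -!mulrA ft1f w'w bf.
  by rewrite /t2 -(mulrA _ t1 f) mulrDl mul1r mulNr bw mulrBr gt1f gb subrr.
clear lt ft1f gt1f t1U bt1U bU zU.
clearbody t2 w.
have l2 := lunit_idl t2U; have r2 := lunit_idr t2U.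
have t2f : t2 * f = w.
  rewrite -[RHS]addr0 -{1}ft2f -gt2f -mulrDl mulrA l2; nc.
pose m : R := f * t2 * g.
have fm : f * m = m by rewrite /m; nc.
have mg : m * g = m by rewrite /m; nc.
have ft2 : f * t2 = w + m.
  have -> : f * t2 = f * (t2 * (f + g)) by rewrite r2; nc.
  by rewrite mulrDr t2f mulrDr fw /m mulrA.
have pm : peirce f g (w' * m) by split; [rewrite mulrA fw' | rewrite -mulrA mg].
have mU : lunit (f + g) (1 + - (w' * m)) (1 - - (w' * m)).
  exact: (lunit_transvection fgf gfg gf0 (peirceN pm)).
have dU := lunit_mul t2U mU.
set d : R := t2 * _ in dU; set d' : R := (1 - _) * t2' in dU.
have mf : m * f = 0 by rewrite -mg -mulrA gf0 mulr0.
have df : d * f = w.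
  by rewrite /d -mulrA mulrDl mul1r mulNr -mulrA mf mulr0 subr0 t2f.
have wm : t2 * (w' * m) = m.
  by rewrite -fw' -mulrA mulrA t2f mulrA ww' fm.
have dE : d = t2 - m by rewrite /d mulrDr mulr1 mulrN wm.
have fd : f * d = w by rewrite dE mulrBr ft2 fm addrK.
clear wm t2f ft2f gt2f ft2 l2 r2 t2U mU.
clearbody m d d'.
have [dd' d'd _ _] := dU.
have d'f : d' * f = w'.
  by rewrite -ww' mulrA -df mulrA d'd mul1r.
have mw' : m * w' = 0 by rewrite -fw' mulrA mf mul0r.
(* Clearing the row gave [d = t2 - m]. Since [t2 = (1 + m * d') * d], this amounts to a transvection
   on the left. *)
have md' : peirce f g (m * d').
  have e1 : m * d' * (f + g) = m * d'.
    by rewrite -mulrA (lunit_idr (lunit_sym dU)); nc.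
  split; first by rewrite mulrA fm.
  by rewrite -[RHS]e1 mulrDr -[m * d' * f]mulrA d'f mw' add0r.
pose v : R := w + 1 - f; pose v' : R := w' + 1 - f.
have vU : lunit f v v' by rewrite /v /v'; split; nc.
have vU2 := lunit_sub (lunit_sym vU) fgf ffg.
have s0U : lunit (f + g) (v' * d) (d' * v) := lunit_mul vU2 dU.
have {}s0U : lunit g (v' * d) (d' * v).
  apply: (lunit_restrict s0U).
    by rewrite -mulrA df /v'; nc.
  have fv' : f * v' = w' by rewrite /v'; nc.
  by rewrite mulrA fv' -{1}w'f -mulrA fd w'w.
have cU := lunit_copy ff gg (conj gal alf) (conj fbe beg) beal albe vU.
have ed := elem_diag ff gg fg (conj gal alf) (conj fbe beg) beal albe vU.
move: cU ed; set c : R := 1 - g + al * v * be.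
set c' : R := 1 - g + al * v' * be => cU ed; clearbody c c'.
have sU := lunit_mul cU s0U.
(* Five pairs: one from [z] and [b * w'], one from [m * d'], and three from [elem_diag] for
   [v * c']. The copy [c] of [v] on [g] stays in the remaining unit. *)
exists ((1 + - z) * (1 + b * w') * ((1 + m * d') * (1 + 0) *
  (v * c'))), (c * (v' * d)), (d' * v * c'); split; last 1 first.
- have [_ cc _ _] := cU; have [vv' _ _ _] := vU.
  rewrite t1E t2E -!mulrA; congr (_ * (_ * _)).
  rewrite (mulrA c') cc mul1r (mulrA v) vv' mul1r addr0 mul1r.
  by rewrite mulrDl mul1r -mulrA d'd mulr1 dE subrK.
- apply: (@elem_mul _ 1 4); first exact: elem1 (peirceN (conj fz zg)) pb.
  by apply: (@elem_mul _ 1 3); first exact: elem1 md' (peirce0 _ _).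
- exact: sU.
Qed.

End Reduction.

(** * The swindle *)

Section Swindle.
Variables (K : realType) (R : pzRingType) (rk : R -> K).
Hypothesis rkP : rank_function rk.
Hypothesis R_irreducible : irreducible_ring R.
Hypothesis R_regular : regular_ring R.
Hypothesis R_complete : complete_lattice (pideal R).
Hypothesis R_meetc : meet_continuous (pideal R).
Hypothesis R_nondiscrete : ~ rank_discrete rk.
Implicit Types a b e f g p q s t u v w x y z : R.

Definition halving e (c d : nat -> R) := c 0%N = e /\ forall n,
  [/\ idempotent_elt (c n), idempotent_elt (d n), orthogonal_elts (c n.+1) (d n),
      c n = c n.+1 + d n & rk (c n.+1) = rk (d n)].

Lemma halving_exists e : idempotent_elt e -> exists c d, halving e c d.
Proof.
move=> ee.
have step (c : R) : exists p : R * R, idempotent_elt c ->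
    [/\ idempotent_elt p.1, idempotent_elt p.2, orthogonal_elts p.1 p.2,
        c = p.1 + p.2 & rk p.1 = rk p.2].
  (* An arbitrary value at non-idempotents makes the halving a total function, to be iterated. *)
  have [cc|] := pselect (idempotent_elt c); last by exists (0, 0).
  have [c1 [c2 H]] := halve rkP R_irreducible R_regular R_complete R_meetc
    R_nondiscrete cc.
  by exists (c1, c2).
have [h hP] := choice step.
pose c := fix c n := if n is n'.+1 then (h (c n')).1 else e.
have cc n : idempotent_elt (c n).
  by elim: n => [//|n IHn]; case: (hP _ IHn).
exists c, (fun n => (h (c n)).2); split=> // n.
by case: (hP _ (cc n)) => ? ? ? ? ?; split.
Qed.

Section HalvingTheory.
Variables (e : R) (c d : nat -> R).
Hypothesis hP : halving e c d.

Lemma halving_cc m n : (m <= n)%N -> c m * c n = c n /\ c n * c m = c n.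
Proof.
have [_ H] := hP.
elim: n => [|n IHn]; first by rewrite leqn0 => /eqP ->; case: (H 0%N).
rewrite leq_eqVlt ltnS => /predU1P[->|/IHn[mn nm]]; first by case: (H n.+1).
have [cn _ [cd dc] cE _] := H n; have [cn1 _ _ _ _] := H n.+1.
have h1 : c n * c n.+1 = c n.+1 by rewrite cE; nc.
have h2 : c n.+1 * c n = c n.+1 by rewrite cE; nc.
by split; [rewrite -h1 mulrA mn | rewrite -h2 -mulrA nm].
Qed.

Lemma halving_dd n : idempotent_elt (d n).
Proof. by have [_ /(_ n)[]] := hP. Qed.

Lemma halving_cd m n : (m <= n)%N -> c m * d n = d n /\ d n * c m = d n.
Proof.
have [_ H] := hP => /halving_cc[mn nm].
have [cn dn [cd dc] cE _] := H n.
have h1 : c n * d n = d n by rewrite cE; nc.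
have h2 : d n * c n = d n by rewrite cE; nc.
by split; [rewrite -h1 mulrA mn | rewrite -h2 -mulrA nm].
Qed.

Lemma halving_ed n : e * d n = d n /\ d n * e = d n.
Proof. by have [<- _] := hP; apply: halving_cd. Qed.

Lemma halving_ec n : e * c n = c n /\ c n * e = c n.
Proof. by have [<- _] := hP; apply: halving_cc. Qed.

Lemma halving_orth m n : m <> n -> d m * d n = 0.
Proof.
have [_ H] := hP.
case: (ltngtP m n) => // mn _.
  have [h1 h2] := halving_cd mn; have [_ _ [cd dc] _ _] := H m.
  exact: (mulr_eq0_sub (halving_dd m) h1 dc).
have [h1 h2] := halving_cd mn; have [_ _ [cd dc] _ _] := H n.
exact: (mulr_eq0_sub h2 (halving_dd n) cd).
Qed.

Lemma halving_rank n : rk (d n) = rk e / 2 ^+ n.+1.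
Proof.
have [c0 H] := hP.
have step m : rk (c m.+1) = rk (c m) / 2.
  have [_ dm cdo cE rcd] := H m; have [cm1 _ _ _ _] := H m.+1.
  by rewrite cE (rank_orthD rkP) // rcd; lra.
have [_ _ _ _ <-] := H n.
elim: n => [|n IHn]; first by rewrite step c0 expr1.
by rewrite step IHn [in RHS]exprS invfM mulrA mulrAC.
Qed.

(** [z] kills all pieces, so [z * e = z * c n] has rank at most that of [c n], which tends to
    [0]. *)
Lemma halving_exhaust z : (forall n, z * d n = 0) -> z * e = 0.
Proof.
move=> zd; have [c0 H] := hP.
have zc n : z * c n = z * e.
  elim: n => [|n IHn]; first by rewrite c0.
  by have [_ _ _ cE _] := H n; rewrite -IHn cE mulrDr zd addr0.
apply: (rank_eq0 rkP); apply/eqP; rewrite eq_le (rank_ge0 rkP) andbT.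
rewrite leNgt; apply/negP => pos.
have le n : rk (z * e) <= (2 ^+ n.+1)^-1.
  rewrite -(zc n.+1); apply: (le_trans (rank_mulr rkP _ _)).
  have [_ _ _ _ ->] := H n; rewrite halving_rank ler_piMl ?(rank_le1 rkP) //.
  by rewrite invr_ge0 exprn_ge0.
have [n] : exists n : nat, (rk (z * e))^-1 < n%:R.
  by exists (Num.bound (rk (z * e))^-1); apply: archi_boundP; rewrite invr_ge0 ltW.
apply/negP; rewrite -leNgt; apply: (@le_trans _ _ (2 ^+ n.+1)).
  by rewrite -natrX ler_nat ltnW // (ltn_trans (ltnSn n)) // ltn_expl.
by rewrite -[leLHS]invrK lef_pV2 ?posrE ?invr_gt0 ?exprn_gt0.
Qed.

End HalvingTheory.

Lemma elem_fix k p q x s : elem k p q x -> p * s = 0 -> q * s = 0 -> x * s = s.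
Proof.
move=> ex ps qs; elim: k x ex => [x ->|k IHk x]; first by rewrite mul1r.
move=> [a [b [y [[_ aq] [_ bp] /IHk ys ->]]]].
have as0 : a * s = 0 by rewrite -aq -mulrA qs mulr0.
have bs0 : b * s = 0 by rewrite -bp -mulrA ps mulr0.
by rewrite -mulrA ys; nc.
Qed.

Lemma elem_stable k f g x : idempotent_elt f -> idempotent_elt g ->
  orthogonal_elts f g -> elem k f g x ->
  (f + g) * (x * (f + g)) = x * (f + g).
Proof.
move=> ff gg fg; elim: k x => [x ->|k IHk x]; first by nc.
move=> [a [b [y [[fa _] [gb _] /IHk + ->]]]]; rewrite -!mulrA.
move: (y * (f + g)) => u uE.
have fb : f * b = 0 by rewrite -gb mulrA (proj1 fg) mul0r.
have ga : g * a = 0 by rewrite -fa mulrA (proj2 fg) mul0r.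
have gu : g * u = u - f * u by rewrite -[in RHS]uE; nc.
by nc.
Qed.

(** All [x n] have the same number [k] of pairs, so the [j]-th entries for all [n] are glued to one
    entry, for each [j]. On [f n + g n] only the entries of [x n] are felt. *)
Lemma elem_glue k p q (f g x : nat -> R) : idempotent_elt p -> idempotent_elt q ->
  orthogonal_elts p q ->
  (forall n, idempotent_elt (f n) /\ p * f n = f n) ->
  (forall n, f n * p = f n) -> (forall m n, m <> n -> f m * f n = 0) ->
  (forall n, idempotent_elt (g n) /\ q * g n = g n) ->
  (forall n, g n * q = g n) -> (forall m n, m <> n -> g m * g n = 0) ->
  (forall n, elem k (f n) (g n) (x n)) ->
  exists2 X, elem k p q X
    & forall n, X * (f n + g n) = x n * (f n + g n).
Proof.
move=> pp qq [pq qp] ff fp fo gg gq go.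
have fg n : f n * g n = 0.
  by have [_ qg] := gg n; apply: mulr_eq0_sub (fp n) qg pq.
have gf n : g n * f n = 0.
  by have [_ pf] := ff n; apply: mulr_eq0_sub (gq n) pf qp.
elim: k x => [x xE|k IHk x xE].
  by exists 1 => // n; rewrite xE.
have /choice[w wP] n : exists w : R * R * R, [/\ peirce (f n) (g n) w.1.1,
    peirce (g n) (f n) w.1.2, elem k (f n) (g n) w.2
    & x n = (1 + w.1.1) * (1 + w.1.2) * w.2].
  by have [a [b [y H]]] := xE n; exists (a, b, y).
have [X eX XP] : exists2 X, elem k p q X
    & forall n, X * (f n + g n) = (w n).2 * (f n + g n).
  by apply: (IHk (fun n => (w n).2)) => n; case: (wP n).
have [A [pA Aq AP]] : exists A, [/\ p * A = A, A * q = A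
    & forall n, A * g n = (w n).1.1].
  apply: (glue R_regular R_complete R_meetc) => // n.
  have [[fa ag] _ _ _] := wP n; split=> //.
  by rewrite -fa mulrA; case: (ff n) => _ ->.
have [B [qB Bp BP]] : exists B, [/\ q * B = B, B * p = B
    & forall n, B * f n = (w n).1.2].
  apply: (glue R_regular R_complete R_meetc) => // n.
  have [_ [gb bf] _ _] := wP n; split=> //.
  by rewrite -gb mulrA; case: (gg n) => _ ->.
exists ((1 + A) * (1 + B) * X); first by exists A, B, X; split.
move=> n; have [[fa ag] [gb bf] ey ->] := wP n.
have [fn pf] := ff n; have [gn qg] := gg n.
rewrite -!mulrA XP.
have := elem_stable fn gn (conj (fg n) (gf n)) ey.
move: ((w n).2 * _) => u uE.
have An := AP n; have Bn := BP n; have fgn := fg n; have gfn := gf n.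
have Af : A * f n = 0 by rewrite -Aq -pf mulrA -(mulrA A) qp mulr0 mul0r.
have Bg : B * g n = 0 by rewrite -Bp -qg mulrA -(mulrA B) pq mulr0 mul0r.
have ub : g n * ((w n).1.2 * u) = (w n).1.2 * u by rewrite mulrA gb.
have Bu : B * u = (w n).1.2 * u.
  have bg : (w n).1.2 * g n = 0 by rewrite -bf -mulrA fgn mulr0.
  by rewrite -uE !mulrA; congr (_ * _); rewrite !mulrDr Bg bg Bn bf.
have Au : A * u = (w n).1.1 * u.
  have af : (w n).1.1 * f n = 0 by rewrite -ag -mulrA gfn mulr0.
  by rewrite -uE !mulrA; congr (_ * _); rewrite !mulrDr Af af An ag.
have Ab : A * ((w n).1.2 * u) = (w n).1.1 * ((w n).1.2 * u).
  by rewrite -gb -!mulrA !(mulrA _ (g n)) An ag.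
by rewrite !mulrDl !mul1r Bu !mulrDr Au Ab.
Qed.

(** [v = (v * u') * u], so modulo transvections [v] is its copy [u] on [g]. *)
Lemma transport f g v v' : idempotent_elt f -> idempotent_elt g ->
  orthogonal_elts f g -> eqv f g -> lunit f v v' ->
  exists u u', lunit g u u' /\ elem 3 f g (v * u').
Proof.
move=> ff gg fg [x [y [px py yx xy]]] vU.
exists (1 - g + x * v * y), (1 - g + x * v' * y).
by split; [apply: (lunit_copy ff) vU | apply: elem_diag vU].
Qed.

Record stage := Stage {
  st_x : R; st_s : R; st_s' : R; st_v : R; st_v' : R; st_u : R; st_u' : R }.

(** One round of the swindle: [t] is reduced to [s] on [g], which is moved to [v] on [h] and then to
    [u] on [k]. Primes denote inverses. *)
Definition stage_spec f g h k t (w : stage) :=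
  [/\ [/\ t = st_x w * st_s w & elem 5 f g (st_x w)],
      lunit g (st_s w) (st_s' w) /\ elem 3 g h (st_s w * st_v' w),
      lunit h (st_v w) (st_v' w) /\ elem 3 h k (st_v w * st_u' w)
    & lunit k (st_u w) (st_u' w)].

Lemma stage_exists f g h k t t' :
  [/\ idempotent_elt f, idempotent_elt g, idempotent_elt h & idempotent_elt k] ->
  [/\ orthogonal_elts f g, orthogonal_elts g h & orthogonal_elts h k] ->
  [/\ rk f = rk g, rk g = rk h & rk h = rk k] ->
  lunit (f + g) t t' -> exists w : stage, stage_spec f g h k t w.
Proof.
move=> [ff gg hh kk] [fg gh hk] [rfg rgh rhk] tU.
have eqvR e e' : idempotent_elt e -> idempotent_elt e' -> orthogonal_elts e e' ->
    rk e = rk e' -> eqv e e'.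
  exact: (rank_eqv rkP R_irreducible R_regular R_complete R_meetc).
have [x [s [s' [ex sU ts]]]] := elem_reduction rkP R_irreducible R_regular
  R_complete R_meetc ff gg fg (eqvR _ _ ff gg fg rfg) tU.
have [v [v' [vU ev]]] := transport gg hh gh (eqvR _ _ gg hh gh rgh) sU.
have [u [u' [uU eu]]] := transport hh kk hk (eqvR _ _ hh kk hk rhk) vU.
by exists (Stage x s s' v v' u u').
Qed.

(* A unit [t_n] of [V n] is modulo transvections a unit [s_n] of its half
   [d2 n], which moves to [d3 n] and then to [V n.+1], of the same rank, where
   it becomes [t_(n+1)].  All the transvections of one kind are glued, so that
   [t_0] is a telescoping product of three glued factors. *)
Lemma swindle p1 p2 p3 (c1 d1 c2 d2 c3 d3 : nat -> R) t t' :
  [/\ idempotent_elt p1, idempotent_elt p2 & idempotent_elt p3] ->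
  [/\ orthogonal_elts p1 p2, orthogonal_elts p1 p3 & orthogonal_elts p2 p3] ->
  rk p1 = rk p2 -> rk p2 = rk p3 ->
  halving p1 c1 d1 -> halving p2 c2 d2 -> halving p3 c3 d3 ->
  lunit (d1 0%N + d2 0%N) t t' ->
  exists X Y Z, [/\ elem 5 p1 p2 X, elem 3 p2 p3 Y,
    elem 3 p3 (p1 + p2 - (d1 0%N + d2 0%N)) Z & t = X * Y * Z].
Proof.
move=> [i1 i2 i3] [[o12 o21] [o13 o31] [o23 o32]] r12 r23 h1 h2 h3 tU.
pose V n := d1 n + d2 n.
have [dd1 [dd2 dd3]] := (halving_dd h1, (halving_dd h2, halving_dd h3)).
have pd1 n : p1 * d1 n = d1 n by case: (halving_ed h1 n).
have dp1 n : d1 n * p1 = d1 n by case: (halving_ed h1 n).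
have pd2 n : p2 * d2 n = d2 n by case: (halving_ed h2 n).
have dp2 n : d2 n * p2 = d2 n by case: (halving_ed h2 n).
have pd3 n : p3 * d3 n = d3 n by case: (halving_ed h3 n).
have dp3 n : d3 n * p3 = d3 n by case: (halving_ed h3 n).
have d12 m n : d1 m * d2 n = 0 := mulr_eq0_sub (dp1 m) (pd2 n) o12.
have d21 m n : d2 m * d1 n = 0 := mulr_eq0_sub (dp2 m) (pd1 n) o21.
have d13 m n : d1 m * d3 n = 0 := mulr_eq0_sub (dp1 m) (pd3 n) o13.
have d31 m n : d3 m * d1 n = 0 := mulr_eq0_sub (dp3 m) (pd1 n) o31.
have d23 m n : d2 m * d3 n = 0 := mulr_eq0_sub (dp2 m) (pd3 n) o23.
have d32 m n : d3 m * d2 n = 0 := mulr_eq0_sub (dp3 m) (pd2 n) o32.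
have p1d2 n : p1 * d2 n = 0 := mulr_eq0_sub i1 (pd2 n) o12.
have p2d1 n : p2 * d1 n = 0 := mulr_eq0_sub i2 (pd1 n) o21.
have p1d3 n : p1 * d3 n = 0 := mulr_eq0_sub i1 (pd3 n) o13.
have p3d1 n : p3 * d1 n = 0 := mulr_eq0_sub i3 (pd1 n) o31.
have p2d3 n : p2 * d3 n = 0 := mulr_eq0_sub i2 (pd3 n) o23.
have p3d2 n : p3 * d2 n = 0 := mulr_eq0_sub i3 (pd2 n) o32.
have d1p2 n : d1 n * p2 = 0 := mulr_eq0_sub (dp1 n) i2 o12.
have d2p1 n : d2 n * p1 = 0 := mulr_eq0_sub (dp2 n) i1 o21.
have d1p3 n : d1 n * p3 = 0 := mulr_eq0_sub (dp1 n) i3 o13.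
have d2p3 n : d2 n * p3 = 0 := mulr_eq0_sub (dp2 n) i3 o23.
have VV n : idempotent_elt (V n).
  have := (dd1 n, dd2 n, d12 n n, d21 n n) => -[[[? ?] ?] ?].
  by rewrite /V; nc.
have Vorth m n : m <> n -> V m * V n = 0.
  move=> mn; have := (halving_orth h1 mn, halving_orth h2 mn) => -[e1 e2].
  by rewrite /V !mulrDr !mulrDl e1 e2 d12 d21 !addr0.
have d3V m n : d3 m * V n = 0 by rewrite mulrDr d31 d32 addr0.
have Vd3 m n : V m * d3 n = 0 by rewrite mulrDl d13 d23 addr0.
(* The two halves of [V n.+1] are one step further than [d3 n], so each has half its rank. *)
have rV n : rk (d3 n) = rk (V n.+1).
  have -> : rk (V n.+1) = rk (d1 n.+1) + rk (d2 n.+1).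
    by apply: (rank_orthD rkP) => //; split.
  rewrite (halving_rank h1) (halving_rank h2) (halving_rank h3) r12 r23.
  by rewrite [in RHS]exprS invfM; lra.
(* The index holds the round and the current unit with its inverse; a default stage makes the choice
   total. *)
have step (i : nat * (R * R)) : exists w : stage, lunit (V i.1) i.2.1 i.2.2 ->
    stage_spec (d1 i.1) (d2 i.1) (d3 i.1) (V i.1.+1) i.2.1 w.
  have [iU|] := pselect (lunit (V i.1) i.2.1 i.2.2); last by exists (Stage 0 0 0 0 0 0 0).
  have [w wP] : exists w : stage,
      stage_spec (d1 i.1) (d2 i.1) (d3 i.1) (V i.1.+1) i.2.1 w; last by exists w.
  apply: stage_exists iU; first by split.
    by split; split.
  by rewrite (halving_rank h1) (halving_rank h2) -rV (halving_rank h3) r12 r23.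
have [F FP] := choice step.
pose T := fix T n : R * R := if n is n'.+1
  then let w := F (n', T n') in (st_u w, st_u' w) else (t, t').
pose w n := F (n, T n).
have TU n : lunit (V n) (T n).1 (T n).2.
  by elim: n => [//|n IHn]; case: (FP (n, T n) IHn).
have wP n : stage_spec (d1 n) (d2 n) (d3 n) (V n.+1) (T n).1 (w n).
  exact: (FP (n, T n) (TU n)).
have {FP step} TS n : T n.+1 = (st_u (w n), st_u' (w n)) by [].
have T0 : T 0%N = (t, t') by [].
clearbody T w; clear F.
(* The complement of [V 0] in [p1 + p2]; it contains every later [V n.+1]. *)
pose q := p1 + p2 - V 0%N.
have qq : idempotent_elt q.
  have := (dd1 0%N, dd2 0%N, d12 0%N 0%N, d21 0%N 0%N) => -[[[? ?] ?] ?].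
  have := (pd1 0%N, pd2 0%N, dp1 0%N, dp2 0%N) => -[[[? ?] ?] ?].
  have := (p1d2 0%N, p2d1 0%N, d1p2 0%N, d2p1 0%N) => -[[[? ?] ?] ?].
  by rewrite /q /V; nc.
have p3q : orthogonal_elts p3 q.
  split; rewrite /q /V.
    by rewrite !(mulrDr, mulrN, opprD) o31 o32 p3d1 p3d2; nc.
  by rewrite !(mulrDl, mulNr, opprD) o13 o23 d1p3 d2p3; nc.
have qV n : q * V n.+1 = V n.+1.
  rewrite /q mulrBl Vorth // subr0 /V !mulrDl !mulrDr.
  by rewrite pd1 pd2 p1d2 p2d1 addr0 add0r.
have Vq n : V n.+1 * q = V n.+1.
  rewrite /q mulrBr Vorth // subr0 /V !mulrDl !mulrDr.
  by rewrite dp1 dp2 d1p2 d2p1 addr0 add0r.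
have [X eX XP] : exists2 X, elem 5 p1 p2 X &
    forall n, X * (d1 n + d2 n) = st_x (w n) * (d1 n + d2 n).
  apply: (elem_glue (f := d1) (g := d2) (x := fun n => st_x (w n))) => //.
  - exact: (halving_orth h1).
  - exact: (halving_orth h2).
  - by move=> n; case: (wP n) => -[].
have [Y eY YP] : exists2 Y, elem 3 p2 p3 Y &
    forall n, Y * (d2 n + d3 n) = st_s (w n) * st_v' (w n) * (d2 n + d3 n).
  apply: (elem_glue (f := d2) (g := d3) (x := fun n => st_s (w n) * st_v' (w n))) => //.
  - exact: (halving_orth h2).
  - exact: (halving_orth h3).
  - by move=> n; case: (wP n) => _ [].
have [Z eZ ZP] : exists2 Z, elem 3 p3 q Z &
    forall n, Z * (d3 n + V n.+1) = st_v (w n) * st_u' (w n) * (d3 n + V n.+1).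
  apply: (elem_glue (f := d3) (g := fun n => V n.+1)
    (x := fun n => st_v (w n) * st_u' (w n))) => //.
  - exact: (halving_orth h3).
  - by move=> m n mn; apply: Vorth => -[].
  - by move=> n; case: (wP n) => _ _ [].
exists X, Y, Z; split=> //.
have Ys n : Y * V n = st_s (w n) * V n.
  have [_ [sU _] [vU _] _] := wP n.
  have Yd1 : Y * d1 n = d1 n by apply: elem_fix eY _ _.
  have sd1 : st_s (w n) * d1 n = d1 n by apply: lunit_fixl sU _.
  rewrite /V !mulrDr Yd1 sd1; congr (_ + _).
  have -> : d2 n = (d2 n + d3 n) * d2 n by rewrite mulrDl d32 addr0 dd2.
  rewrite mulrA YP -mulrA mulrDl d32 addr0 dd2 -mulrA.
  by rewrite (lunit_fixl (lunit_sym vU)).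
have sV n : V n * (st_s (w n) * V n) = st_s (w n) * V n.
  have [_ [sU _] _ _] := wP n; apply: lunit_stable (VV n) (lunit_sub sU _ _).
    by rewrite /V mulrDl d12 add0r dd2.
  by rewrite /V mulrDr d21 add0r dd2.
have XYV n : X * (Y * V n) = (T n).1 * V n.
  have [[tE _] _ _ _] := wP n.
  by rewrite Ys -sV mulrA XP -mulrA -/(V n) sV tE !mulrA.
have ZV n : Z * V n.+1 = (T n.+1).2 * V n.+1.
  have [_ _ [vU _] uU] := wP n.
  have -> : V n.+1 = (d3 n + V n.+1) * V n.+1 by rewrite mulrDl d3V add0r VV.
  rewrite mulrA ZP -mulrA mulrDl d3V add0r VV TS /=.
  have l := lunit_idl (lunit_sym uU); have r := lunit_idr (lunit_sym uU).
  have uV : st_u' (w n) * V n.+1 = V n.+1 * (st_u' (w n)) by rewrite l r.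
  by rewrite -mulrA uV mulrA (lunit_fixl vU).
have tV n : V n * ((T n).2 * V n) = (T n).2 * V n.
  by apply: lunit_stable (VV n) (lunit_sym (TU n)).
(* On [V 0] the factor [Z] is trivial and [X * Y] acts as [t]. On [V n.+1] the factor [Z] acts as
   the inverse of the unit [t_(n+1)] and [X * Y] as that unit, so they cancel, and [t] is trivial
   there. *)
have main_V n : X * Y * Z * V n = t * V n.
  case: n => [|n].
    have ZV0 : Z * V 0%N = V 0%N.
      apply: elem_fix eZ _ _; first by rewrite /V mulrDr p3d1 p3d2 addr0.
      rewrite /q mulrBl VV /V mulrDl !mulrDr pd1 pd2 p1d2 p2d1 addr0 add0r.
      exact: subrr.
    by rewrite -!mulrA ZV0 XYV T0.
  have [tt' _ _ _] := TU n.+1.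
  rewrite -!mulrA ZV -tV (mulrA Y) (mulrA X) XYV -mulrA tV mulrA tt' mul1r.
  by rewrite (lunit_fixl tU) //; apply: Vorth.
(* On [d3 n] the factor [Z] acts as [v] and [Y] as [s * v']; what remains is [s], which is trivial
   there, as are [X] and [t]. *)
have main_3 n : X * Y * Z * d3 n = t * d3 n.
  rewrite (lunit_fixl tU); last exact: Vd3.
  have [_ [sU _] [vU _] uU] := wP n.
  have Zd3 : Z * d3 n = st_v (w n) * d3 n.
    have -> : d3 n = (d3 n + V n.+1) * d3 n by rewrite mulrDl Vd3 addr0 dd3.
    rewrite mulrA ZP -mulrA mulrDl Vd3 addr0 dd3 -mulrA.
    by rewrite (lunit_fixl (lunit_sym uU)).
  have d3v : d3 n * (st_v (w n) * d3 n) = st_v (w n) * d3 n.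
    exact: lunit_stable (dd3 n) vU.
  have Yd3 : Y * d3 n = st_s (w n) * st_v' (w n) * d3 n.
    have -> : d3 n = (d2 n + d3 n) * d3 n by rewrite mulrDl d23 add0r dd3.
    by rewrite mulrA YP -mulrA.
  have [_ v'v _ _] := vU.
  rewrite -!mulrA Zd3 -d3v (mulrA Y) Yd3 -!mulrA d3v (mulrA (st_v' _)) v'v mul1r.
  by rewrite (lunit_fixl sU) // (elem_fix eX).
have main_0 : X * Y * Z * (1 - p1 - p2 - p3) = t * (1 - p1 - p2 - p3).
  have e1 : p1 * (1 - p1 - p2 - p3) = 0 by nc.
  have e2 : p2 * (1 - p1 - p2 - p3) = 0 by nc.
  have e3 : p3 * (1 - p1 - p2 - p3) = 0 by nc.
  rewrite -!mulrA (elem_fix eZ) // ?(elem_fix eY) // ?(elem_fix eX) //.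
    rewrite (lunit_fixl tU) // -(dp1 0%N) -(dp2 0%N) mulrDl -!mulrA e1 e2.
    by rewrite !mulr0 addr0.
  rewrite /q /V -(dp1 0%N) -(dp2 0%N) mulrBl !mulrDl -!mulrA e1 e2.
  by rewrite !mulr0 addr0 subrr.
have Vd1 n : V n * d1 n = d1 n by rewrite mulrDl d21 addr0 dd1.
have Vd2 n : V n * d2 n = d2 n by rewrite mulrDl d12 add0r dd2.
have ex1 : (t - X * Y * Z) * p1 = 0.
  apply: (halving_exhaust h1) => n.
  by rewrite -Vd1 mulrA (mulrBl (V n)) main_V subrr mul0r.
have ex2 : (t - X * Y * Z) * p2 = 0.
  apply: (halving_exhaust h2) => n.
  by rewrite -Vd2 mulrA (mulrBl (V n)) main_V subrr mul0r.
have ex3 : (t - X * Y * Z) * p3 = 0.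
  by apply: (halving_exhaust h3) => n; rewrite mulrBl main_3 subrr.
apply: subr0_eq; have : (t - X * Y * Z) * (1 - p1 - p2 - p3) = 0.
  by rewrite mulrBl main_0 subrr.
by rewrite !(mulrBr (t - _)) mulr1 ex1 ex2 ex3 !subr0.
Qed.

End Swindle.

(** * Bounded sets of units *)

Section TransvectionIdentities.
Variable R : pzRingType.
Implicit Types a b e f g p q r s x y : R.

Lemma transvection_comm a x : a * a = 0 -> x * a = 0 -> x * x = 0 ->
  (1 + a) * (1 + x) * (1 - a) * (1 - x) = 1 + a * x.
Proof. by move=> aa xa xx; nc. Qed.

Lemma peirce_sqr0 p q a : q * p = 0 -> peirce p q a -> a * a = 0.
Proof. by move=> qp [pa aq]; apply: mulr_eq0_sub aq pa qp. Qed.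

Lemma transvection_inv a : a * a = 0 ->
  (1 - a) * (1 + a) = 1 /\ (1 + a) * (1 - a) = 1.
Proof. by move=> aa; split; nc. Qed.

(** The involution [1 - f - g + x + y] exchanges [f] and [g] and is the identity on their
    complement. *)
Lemma eqv_swap f g : idempotent_elt f -> idempotent_elt g ->
  orthogonal_elts f g -> eqv f g -> exists s, [/\ s * s = 1,
    (forall x, f * x = 0 -> g * x = 0 -> s * x = x)
    & (forall a, a * g = a -> a * s * f = a * s)].
Proof.
move=> ff gg [fg gf] [x [y [[gx xf] [fy yg] yx xy]]].
have xx : x * x = 0 := mulr_eq0_sub xf gx fg.
have yy : y * y = 0 := mulr_eq0_sub yg fy gf.
have fx : f * x = 0 by rewrite -gx mulrA fg mul0r.
have gy : g * y = 0 by rewrite -fy mulrA gf mul0r.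
have yf : y * f = 0 by rewrite -yg -mulrA gf mulr0.
have xg : x * g = 0 by rewrite -xf -mulrA fg mulr0.
exists (1 - f - g + x + y); split; first by nc.
  move=> z fz gz; have xz : x * z = 0 by rewrite -xf -mulrA fz mulr0.
  have yz : y * z = 0 by rewrite -yg -mulrA gz mulr0.
  by nc.
move=> a ag; have af : a * f = 0 by rewrite -ag -mulrA gf mulr0.
have ay : a * y = 0 by rewrite -ag -mulrA gy mulr0.
by nc.
Qed.

(** With [s] from [eqv_swap], a transvection in E(p, g) is a conjugate of one in E(p, f). *)
Lemma transvection_conj p f g s a : s * s = 1 ->
  (forall x, f * x = 0 -> g * x = 0 -> s * x = x) -> f * p = 0 -> g * p = 0 ->
  peirce p g a -> s * (1 + a * s) * s = 1 + a.
Proof.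
move=> ss sfix fp gp [pa ag].
have sa : s * a = a.
  by apply: sfix; rewrite -pa mulrA ?fp ?gp mul0r.
by nc.
Qed.

Lemma transvection_split p c d a : c * p = 0 -> peirce p (c + d) a ->
  1 + a = (1 + a * c) * (1 + a * d).
Proof.
move=> cp [pa acd]; have ca : c * a = 0 by rewrite -pa mulrA cp mul0r.
by rewrite -{1}acd; nc.
Qed.

End TransvectionIdentities.

Section SetPower.
Variable G : groupType.
Implicit Types (W : set G) (m : nat).

Lemma set_power1 W g : W g -> set_power W 1 g.
Proof. by move=> Wg; exists (fun=> g) => //=; rewrite big_ord1. Qed.

Lemma set_powerM W m m' g g' : set_power W m g -> set_power W m' g' ->
  set_power W (m + m') (g * g')%g.
Proof.
move=> [w /= Ww <-] [w' /= Ww' <-].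
exists (fun i => match fintype.split i with inl j => w j | inr j => w' j end).
  by move=> i /=; case: (fintype.split i).
rewrite big_split_ord /=; congr (_ * _)%g; apply: eq_bigr => i _.
  by rewrite (unsplitK (inl i : 'I_m + 'I_m')).
by rewrite (unsplitK (inr i : 'I_m + 'I_m')).
Qed.

Lemma set_powerS W W' m : W `<=` W' -> set_power W m `<=` set_power W' m.
Proof. by move=> WW' _ [w Ww <-]; exists w => // i; apply/WW'/Ww. Qed.

End SetPower.

(** * Boundedness with respect to an increasing cover of the unit group *)

Section Bounded.
Variables (R : unitRingType) (W : nat -> set (GL R)).
Hypothesis W_incr : forall n, W n `<=` W n.+1.
Hypothesis W_cover : \bigcup_n W n = setT.
Implicit Types (X Y : set R).

Lemma W_le m n : (m <= n)%N -> W m `<=` W n.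
Proof.
elim: n => [|n IHn]; first by rewrite leqn0 => /eqP ->.
rewrite leq_eqVlt ltnS => /predU1P[->//|/IHn mn].
exact: subset_trans (@W_incr n).
Qed.

Lemma W_ex g : exists n, W n g.
Proof. by have : setT g by []; rewrite -W_cover => -[n _]; exists n. Qed.

(** Formulated for subsets of [R] rather than of [GL R], so that ring identities apply directly. *)
Definition bounded X := exists n m, forall x, X x ->
  exists2 g, set_power (W n) m g & GL_val g = x.

Lemma bounded_sub X Y : X `<=` Y -> bounded Y -> bounded X.
Proof. by move=> XY [n [m H]]; exists n, m => x /XY /H. Qed.

Lemma bounded_unit (u : R) : u \is a GRing.unit -> bounded [set u].
Proof.
move=> uu; have [n Wn] := W_ex (MkGL uu); exists n, 1%N => _ ->.
by exists (MkGL uu) => //; apply: set_power1.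
Qed.

Lemma bounded_W n : bounded [set GL_val g | g in W n].
Proof. by exists n, 1%N => _ [g Wg <-]; exists g => //; apply: set_power1. Qed.

Lemma bounded_mul X Y : bounded X -> bounded Y ->
  bounded [set x * y | x in X & y in Y].
Proof.
move=> [n [m H]] [n' [m' H']]; exists (maxn n n'), (m + m')%N.
move=> _ [x /H[g gP <-]] [y /H'[g' gP' <-]] <-; exists (g * g')%g => //.
apply: set_powerM; [apply: set_powerS gP | apply: set_powerS gP'].
  exact/W_le/leq_maxl.
exact/W_le/leq_maxr.
Qed.

Lemma bounded_GL : bounded [set u | u \is a GRing.unit] ->
  exists m n : nat, set_power (W n) m = setT.
Proof.
move=> [n [m H]]; exists m, n; apply/seteqP; split=> // g _.
have [h hP hg] := H _ (GL_unitP g).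
by have <- : h = g by apply: val_inj.
Qed.

Variables (K : realType) (rk : R -> K).
Hypothesis rkP : rank_function rk.
Hypothesis R_irreducible : irreducible_ring R.
Hypothesis R_regular : regular_ring R.
Hypothesis R_complete : complete_lattice (pideal R).
Hypothesis R_meetc : meet_continuous (pideal R).
Hypothesis R_nondiscrete : ~ rank_discrete rk.

Definition transvections (p q : R) : set R := [set 1 + a | a in peirce p q].

Lemma transvection_unit (a : R) : a * a = 0 -> 1 + a \is a GRing.unit.
Proof. by move=> /transvection_inv aa; apply/unitrP; exists (1 - a). Qed.

(* If for every [n] some [a_n] in [p R (s n)] were not the restriction of an [A]
   with [1 + A] and [1 - A] in [W n], the glued [a_n] would lie in no [W n]. *)
Lemma full_index (p q : R) (s : nat -> R) : idempotent_elt p ->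
  idempotent_elt q -> orthogonal_elts p q ->
  (forall n, idempotent_elt (s n) /\ q * s n = s n) ->
  (forall n, s n * q = s n) -> (forall m n, m <> n -> s m * s n = 0) ->
  exists n, forall a, peirce p (s n) a -> exists A, [/\ peirce p q A,
    A * s n = a, [set GL_val g | g in W n] (1 + A)
    & [set GL_val g | g in W n] (1 - A)].
Proof.
move=> pp qq pq sq qs so; apply: contrapT => no.
have /choice[a aP] n : exists a, peirce p (s n) a /\
    forall A, peirce p q A -> A * s n = a ->
      [set GL_val g | g in W n] (1 + A) -> ~ [set GL_val g | g in W n] (1 - A).
  apply: contrapT => na; apply: no; exists n => a pa.
  apply: contrapT => nA; apply: na; exists a; split=> // A pA As W1 W2.
  by apply: nA; exists A.
have [A [pA Aq As]] := glue R_regular R_complete R_meetc pp qq pq sq qs so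
  (fun n => (aP n).1).
have AA : A * A = 0 := peirce_sqr0 pq.2 (conj pA Aq).
have u1 := transvection_unit AA.
have u2 : 1 - A \is a GRing.unit.
  by apply: transvection_unit; rewrite mulrNN.
have [m1 Wm1] := W_ex (MkGL u1); have [m2 Wm2] := W_ex (MkGL u2).
apply: ((aP (maxn m1 m2)).2 A (conj pA Aq) (As _)).
  by exists (MkGL u1) => //; apply: W_le Wm1; apply: leq_maxl.
by exists (MkGL u2) => //; apply: W_le Wm2; apply: leq_maxr.
Qed.

Lemma bounded_transvections (p r : R) : idempotent_elt p -> idempotent_elt r ->
  orthogonal_elts p r -> bounded (transvections p r).
Proof.
move=> pp rr [pr rp].
have eqvR (e e' : R) : idempotent_elt e -> idempotent_elt e' -> orthogonal_elts e e' ->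
    rk e = rk e' -> eqv e e'.
  exact: (rank_eqv rkP R_irreducible R_regular R_complete R_meetc).
have halvR := halving_exists rkP R_irreducible R_regular R_complete R_meetc
  R_nondiscrete.
have [c [d h]] := halvR r rr.
(* The pieces [d' n] of the first half [d 0] serve as [s_n]. The matching [d n.+1] lies in the other
   half of [r] and has the same rank, [rk r / 2 ^+ n.+2]. *)
have [c' [d' h']] := halvR (d 0%N) (halving_dd h 0%N).
have pd n : p * d n = 0.
  by have [rd _] := halving_ed h n; apply: mulr_eq0_sub pp rd pr.
have dp n : d n * p = 0.
  by have [_ dr] := halving_ed h n; apply: mulr_eq0_sub dr pp rp.
have cp n : c n * p = 0.
  by have [_ cr] := halving_ec h n; apply: mulr_eq0_sub cr pp rp.
have [n full] : exists n, forall a, peirce p (d' n) a -> exists A,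
    [/\ peirce p (d 0%N) A, A * d' n = a, [set GL_val g | g in W n] (1 + A)
      & [set GL_val g | g in W n] (1 - A)].
  apply: full_index => //; first exact: (halving_dd h).
  - by split; [apply: (halving_dd h') | case: (halving_ed h' n)].
  - by move=> n; case: (halving_ed h' n).
  - exact: (halving_orth h').
have bdn : bounded (transvections p (d n.+1)).
  have [d0d' d'd0] := halving_ed h' n.
  have d0d : d 0%N * d n.+1 = 0 by apply: (halving_orth h).
  have dd0 : d n.+1 * d 0%N = 0 by apply: (halving_orth h).
  have od : orthogonal_elts (d n.+1) (d' n).
    split; first exact: mulr_eq0_sub (halving_dd h n.+1) d0d' dd0.
    exact: mulr_eq0_sub d'd0 (halving_dd h n.+1) d0d.
  have rd : rk (d n.+1) = rk (d' n).
    rewrite (halving_rank rkP h') !(halving_rank rkP h) expr1 exprS invfM.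
    by lra.
  have [x [y [[d'x xd] [dy yd'] yx xy]]] :=
    eqvR _ _ (halving_dd h n.+1) (halving_dd h' n) od rd.
  have xx : x * x = 0 := mulr_eq0_sub xd d'x od.1.
  have x1 : 1 + x \is a GRing.unit := transvection_unit xx.
  have x2 : 1 - x \is a GRing.unit by apply: transvection_unit; rewrite mulrNN.
  apply: bounded_sub (bounded_mul (bounded_mul (bounded_mul
    (bounded_W n) (bounded_unit x1)) (bounded_W n)) (bounded_unit x2)).
  move=> _ [a [pa ad] <-].
  have [|A [pA Ad' W1 W2]] := full (a * y).
    by split; rewrite ?mulrA ?pa // -mulrA yd'.
  have AA : A * A = 0 := peirce_sqr0 (dp 0%N) pA.
  have xA : x * A = 0 by apply: mulr_eq0_sub xd pA.1 (dp n.+1).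
  have AxE : A * x = a by rewrite -d'x mulrA Ad' -mulrA yx.
  exists ((1 + A) * (1 + x) * (1 - A)); last first.
    by exists (1 - x) => //; rewrite transvection_comm // AxE.
  exists ((1 + A) * (1 + x)); last by exists (1 - A).
  by exists (1 + A) => //; exists (1 + x).
(* [c m] is the sum of [d m] and [c m.+1], and a swap conjugates the transvections for [c m.+1] into
   those for [d m]. *)
have climb m : bounded (transvections p (d m)) -> bounded (transvections p (c m)).
  have [_ /(_ m)[_ dm [cd dc] cE rcd]] := h => bd.
  have [_ /(_ m.+1)[cm1 _ _ _ _]] := h.
  have [s [ss sfix sd]] := eqv_swap dm cm1 (conj dc cd)
    (eqvR _ _ dm cm1 (conj dc cd) (esym rcd)).
  have su : s \is a GRing.unit by apply/unitrP; exists s.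
  apply: bounded_sub (bounded_mul (bounded_mul (bounded_mul (bounded_unit su) bd)
    (bounded_unit su)) bd).
  move=> _ [a pa <-]; rewrite cE in pa.
  have pac : peirce p (c m.+1) (a * c m.+1).
    by split; rewrite ?mulrA ?pa.1 // -mulrA cm1.
  have pad : peirce p (d m) (a * d m).
    by split; rewrite ?mulrA ?pa.1 // -mulrA dm.
  exists (1 + a * c m.+1); last first.
    by exists (1 + a * d m); [exists (a * d m) | rewrite -(transvection_split (cp _) pa)].
  exists (s * (1 + a * c m.+1 * s)); last first.
    by exists s => //; rewrite (transvection_conj ss sfix (dp m) (cp _) pac).
  exists s => //; exists (1 + a * c m.+1 * s) => //; exists (a * c m.+1 * s) => //.
  by split; [rewrite !mulrA pa.1 | apply: sd; rewrite -mulrA cm1].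
(* A swap passes from [c m.+1] to [d m], and [climb] from there to [c m]; iteration ends at
   [c 0 = r]. *)
have descend m : bounded (transvections p (c m.+1)) -> bounded (transvections p (c m)).
  have [_ /(_ m)[_ dm [cd dc] cE rcd]] := h => bc.
  have [_ /(_ m.+1)[cm1 _ _ _ _]] := h; apply: climb.
  have [s [ss sfix sd]] := eqv_swap cm1 dm (conj cd dc)
    (eqvR _ _ cm1 dm (conj cd dc) rcd).
  have su : s \is a GRing.unit by apply/unitrP; exists s.
  apply: bounded_sub (bounded_mul (bounded_mul (bounded_unit su) bc)
    (bounded_unit su)).
  move=> _ [a pa <-]; exists (s * (1 + a * s)); last first.
    by exists s => //; rewrite (transvection_conj ss sfix (cp _) (dp m) pa).
  exists s => //; exists (1 + a * s) => //; exists (a * s) => //.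
  by split; [rewrite mulrA pa.1 | apply: sd; case: pa].
have {climb} := climb _ bdn; elim: n.+1 => [|m IHm /descend //].
by case: h => ->.
Qed.

Lemma bounded_elem k (p q : R) : idempotent_elt p -> idempotent_elt q ->
  orthogonal_elts p q -> bounded (elem k p q).
Proof.
move=> pp qq pq; elim: k => [|k IHk].
  by apply: bounded_sub (bounded_unit (unitr1 R)) => x.
apply: bounded_sub (bounded_mul (bounded_mul (bounded_transvections pp qq pq)
  (bounded_transvections qq pp (conj pq.2 pq.1))) IHk).
move=> _ [a [b [y [pa pb ey ->]]]]; exists ((1 + a) * (1 + b)); last by exists y.
by exists (1 + a); [exists a | exists (1 + b) => //; exists b].
Qed.

End Bounded.

(** * Uniform factorization of units into transvections *)

Section Factorization.
Variables (K : realType) (R : pzRingType) (rk : R -> K).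
Hypothesis rkP : rank_function rk.
Hypothesis R_irreducible : irreducible_ring R.
Hypothesis R_regular : regular_ring R.
Hypothesis R_complete : complete_lattice (pideal R).
Hypothesis R_meetc : meet_continuous (pideal R).
Hypothesis R_nondiscrete : ~ rank_discrete rk.

(** The list fixes the types of the factors and their order; one list for all units is what makes
    the factorization uniform. *)
Definition elem_product (s : seq (nat * R * R)) (x : R) :=
  foldr (fun i X x => exists y z, [/\ elem i.1.1 i.1.2 i.2 y, X z & x = y * z])
    (fun x => x = 1) s x.

Lemma unit_factorization : exists s : seq (nat * R * R),
  (forall k p q, List.In (k, p, q) s -> [/\ idempotent_elt p, idempotent_elt q
     & orthogonal_elts p q]) /\
  (forall u u' : R, u * u' = 1 -> u' * u = 1 -> elem_product s u).
Proof.
have eqvR (e e' : R) : idempotent_elt e -> idempotent_elt e' ->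
    orthogonal_elts e e' -> rk e = rk e' -> eqv e e'.
  exact: (rank_eqv rkP R_irreducible R_regular R_complete R_meetc).
have halveR := halve rkP R_irreducible R_regular R_complete R_meetc R_nondiscrete.
have halvR := halving_exists rkP R_irreducible R_regular R_complete R_meetc
  R_nondiscrete.
have reduce := elem_reduction rkP R_irreducible R_regular R_complete R_meetc.
have i1 : idempotent_elt (1 : R) by rewrite /idempotent_elt mulr1.
have [P [Q [PP QQ [PQ QP] E1 rPQ]]] := halveR 1 i1.
have [p1 [p2 [pp1 pp2 [p12 p21] PE r12]]] := halveR P PP.
have [p3 [p4 [pp3 pp4 [p34 p43] QE r34]]] := halveR Q QQ.
have Pp1 : P * p1 = p1 by rewrite PE; nc.
have p1P : p1 * P = p1 by rewrite PE; nc.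
have Pp2 : P * p2 = p2 by rewrite PE; nc.
have p2P : p2 * P = p2 by rewrite PE; nc.
have Qp3 : Q * p3 = p3 by rewrite QE; nc.
have p3Q : p3 * Q = p3 by rewrite QE; nc.
have p13 : orthogonal_elts p1 p3.
  by split; [apply: mulr_eq0_sub p1P Qp3 PQ | apply: mulr_eq0_sub p3Q Pp1 QP].
have p23 : orthogonal_elts p2 p3.
  by split; [apply: mulr_eq0_sub p2P Qp3 PQ | apply: mulr_eq0_sub p3Q Pp2 QP].
have r23 : rk p2 = rk p3.
  have := rPQ; rewrite PE QE !(rank_orthD rkP) //; lra.
have [c1 [d1 h1]] := halvR p1 pp1; have [c2 [d2 h2]] := halvR p2 pp2.
have [c3 [d3 h3]] := halvR p3 pp3.
have [c10 /(_ 0%N)[_ d1i [cd1 dc1] cE1 rcd1]] := h1; rewrite c10 in cE1.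
have [c20 /(_ 0%N)[_ d2i [cd2 dc2] cE2 rcd2]] := h2; rewrite c20 in cE2.
have [_ /(_ 1%N)[c1i _ _ _ _]] := h1; have [_ /(_ 1%N)[c2i _ _ _ _]] := h2.
have [p1d1 d1p1] := halving_ed h1 0; have [p2d2 d2p2] := halving_ed h2 0.
have [p1c1 c1p1] := halving_ec h1 1; have [p2c2 c2p2] := halving_ec h2 1.
have z1 : d1 0%N * d2 0%N = 0 := mulr_eq0_sub d1p1 p2d2 p12.
have z2 : d2 0%N * d1 0%N = 0 := mulr_eq0_sub d2p2 p1d1 p21.
have z3 : c1 1%N * c2 1%N = 0 := mulr_eq0_sub c1p1 p2c2 p12.
have z4 : c2 1%N * c1 1%N = 0 := mulr_eq0_sub c2p2 p1c1 p21.
have z5 : c1 1%N * d2 0%N = 0 := mulr_eq0_sub c1p1 p2d2 p12.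
have z6 : d2 0%N * c1 1%N = 0 := mulr_eq0_sub d2p2 p1c1 p21.
have z7 : c2 1%N * d1 0%N = 0 := mulr_eq0_sub c2p2 p1d1 p21.
have z8 : d1 0%N * c2 1%N = 0 := mulr_eq0_sub d1p1 p2c2 p12.
(* [U] and [V] are halves of [P], each of rank one quarter. The first reduction goes from [1] to
   [P], the second from [P] to [V], where [swindle] starts. *)
pose V : R := d1 0%N + d2 0%N; pose U : R := c1 1%N + c2 1%N.
have VV : idempotent_elt V by rewrite /V; nc.
have UU : idempotent_elt U by rewrite /U; nc.
have UV : orthogonal_elts U V by rewrite /U /V; split; nc.
have PUV : P = U + V by rewrite PE cE1 cE2 /U /V addrACA.
have rUV : rk U = rk V.
  by rewrite !(rank_orthD rkP) ?rcd1 ?rcd2 //; split.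
(* This equals [U], written in the form that [swindle] produces. *)
pose W : R := p1 + p2 - V.
have WW : idempotent_elt W.
  have -> : W = U by rewrite /W -PE PUV addrK.
  by [].
have p3W : orthogonal_elts p3 W.
  have [p13_ p31] := p13; have [p23_ p32] := p23.
  have -> : W = U by rewrite /W -PE PUV addrK.
  split.
    apply: (mulr_eq0_sub p3Q _ QP); rewrite PUV; case: UV => _ VU0; nc.
  by apply: (mulr_eq0_sub _ Qp3 PQ); rewrite PUV; case: UV => UV0 _; nc.
exists [:: (5, Q, P); (5, U, V); (5, p1, p2); (3, p2, p3); (3, p3, W)]%N.
split.
  by move=> k p q /= [|[|[|[|[|[]]]]]] [_ <- <-]; split.
move=> u u' uu' u'u.
have uU : lunit (Q + P) u u'.
  by rewrite addrC -E1; split; rewrite ?subrr ?mulr0 ?mul0r.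
have [x [s [s' [ex sU ->]]]] := reduce _ _ _ _ QQ PP (conj QP PQ)
  (eqvR _ _ QQ PP (conj QP PQ) (esym rPQ)) uU.
rewrite PUV in sU.
have [y [t [t' [ey tU ->]]]] := reduce _ _ _ _ UU VV UV (eqvR _ _ UU VV UV rUV) sU.
have [X [Y [Z [eX eY eZ ->]]]] := swindle rkP R_irreducible R_regular R_complete
  R_meetc (And3 pp1 pp2 pp3) (And3 (conj p12 p21) p13 p23) r12 r23 h1 h2 h3 tU.
exists x, (y * (X * Y * Z)); split=> //; exists y, (X * Y * Z); split=> //.
exists X, (Y * Z); split=> //; last by rewrite mulrA.
by exists Y, Z; split=> //; exists Z, 1; rewrite mulr1.
Qed.

End Factorization.

Theorem theorem1p3 (K : realType) (R : unitRingType) (rk : R -> K)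
  (R_irreducible : irreducible_ring R) (R_continuous : continuous_ring R)
  (rk_rank : rank_function rk) (R_nondiscrete : ~ rank_discrete rk) :
  uncountable_strong_cofinality (GL R).
Proof.
have [regR compR meetR _] := R_continuous.
move=> W W_incr W_cover; apply: bounded_GL.
have [s [sP sE]] := unit_factorization rk_rank R_irreducible regR compR meetR
  R_nondiscrete.
have bs : bounded W (elem_product s).
  (* A product of finitely many bounded sets is bounded. *)
  elim: s sP {sE} => [|[[k p] q] s IHs] sP /=.
    by apply: bounded_sub (bounded_unit W_cover (unitr1 R)) => x.
  have [pp qq pq] := sP k p q (or_introl erefl).
  have bs : bounded W (elem_product s).
    by apply: IHs => k' p' q' ins; apply: (sP k'); right.
  apply: bounded_sub (bounded_mul W_incr (bounded_elem W_incr W_cover rk_rank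
    R_irreducible regR compR meetR R_nondiscrete k pp qq pq) bs).
  by move=> _ [y [z [ey ez ->]]]; exists y => //; exists z.
apply: bounded_sub bs => u /= uu; apply: (sE u u^-1).
  by rewrite mulrV.
by rewrite mulVr.
Qed.
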